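(* Let $0<\alpha<1$ and $f\in C^\infty(\mathbb{R})$. Given $\varepsilon>0$, $\eta\in C(\mathbb{R})$ convex and $u^\varepsilon\in C^2_b((0,\infty)\times\mathbb{R})$ a solution of the Cauchy problem $$\partial_t u^\varepsilon+\partial_x f(u^\varepsilon)=\varepsilon\,\partial_x\mathcal{D}^\alpha[u^\varepsilon]\quad (t>0,\ x\in\mathbb{R}),\qquad u^\varepsilon(0,x)=u_0(x)\quad (x\in\mathbb{R}),$$ then for all $\varphi\in C_c^\infty((0,\infty)\times\mathbb{R})$ $$\int_0^\infty\!\!\int_{\mathbb{R}}\Big(\eta(u^\varepsilon(t,x))\,\partial_t\varphi(t,x)+q(u^\varepsilon(t,x))\,\partial_x\varphi(t,x)+\varepsilon\,\eta(u^\varepsilon(t,x))\,\partial_x\overline{\mathcal{D}^\alpha}[\varphi(t,\cdot)](x)\Big)\,dx\,dt\ \ge\ 0,$$ where $q$ is given by $$q(u)=f'(u)\eta(u)-f'(0)\eta(0)-\int_0^uf''(z)\eta(z)\,dz .$$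
   Context: For $0<\alpha<1$ and $d_\alpha=\frac{1}{\Gamma(1-\alpha)}$, $$\mathcal{D}^\alpha[g](x)=d_\alpha\int_{-\infty}^x\frac{g'(z)}{(x-z)^\alpha}\,dz,\qquad \overline{\mathcal{D}^\alpha}[g](x)=d_\alpha\int_x^\infty\frac{g'(z)}{(z-x)^\alpha}\,dz,$$ both acting on the $x$ variable only. $u_0$ is the given initial datum. $C^2_b$ denotes $C^2$ functions that are bounded together with their derivatives up to order two.
   Formalization: The inequality is stated for nonnegative test functions φ only; for φ of arbitrary sign it would force equality, which fails e.g. for f=0, η(u)=u² and a damped travelling cosine solution. *)

(* Defs.v *)
From HB Require Import structures.
From mathcomp Require Import all_boot all_order all_algebra.
From mathcomp Require Import all_classical all_reals all_analysis.

Set Implicit Arguments.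
Unset Strict Implicit.
Unset Printing Implicit Defensive.

Import Order.TTheory GRing.Theory Num.Theory.
Import numFieldNormedType.Exports.

Local Open Scope classical_set_scope.
Local Open Scope ring_scope.

Section FractionalDerivatives.
Context {R : realType}.
Local Notation mu := (@lebesgue_measure R).
Implicit Types (alpha x : R) (g : R -> R).

(* Euler's integral; only meaningful for 0 < s. *)
Definition Gamma (s : R) : R :=
  \int[mu]_(r in `]0%R, +oo[) (r `^ (s - 1) * expR (- r)).

Definition dcoef alpha : R := (Gamma (1 - alpha))^-1.

(* The integrals over the half-lines are improper at infinity: when g is merely
   bounded together with its derivatives, g' z / |x - z| `^ alpha is in general
   not Lebesgue integrable near infinity, and only the limit of the truncated
   integrals makes sense. The singularity at z = x is Lebesgue integrable. *)
Definition Dleft alpha g x : R :=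
  dcoef alpha *
  lim ((\int[mu]_(z in `]a, x[) (derive1 g z / (x - z) `^ alpha)) @[a --> -oo]).

Definition Dright alpha g x : R :=
  dcoef alpha *
  lim ((\int[mu]_(z in `]x, b[) (derive1 g z / (z - x) `^ alpha)) @[b --> +oo]).

End FractionalDerivatives.

Section Regularity.
Context {R : realType}.
Implicit Types (f : R -> R) (g : R -> R -> R) (Omega : set (R * R)).

(* Functions of (t, x) are curried, the time variable coming first. *)
Definition dt g : R -> R -> R := fun t x => derive1 (g ^~ x) t.
Definition dx g : R -> R -> R := fun t x => derive1 (g t) x.

(* Only used for open Omega. *)
Fixpoint Ck (k : nat) Omega g : Prop :=
  (forall p, Omega p -> {for p, continuous (fun q : R * R => g q.1 q.2)}) /\
  (if k is k'.+1 then
     [/\ forall p, Omega p ->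
           derivable (g ^~ p.2) p.1 1 /\ derivable (g p.1) p.2 1,
         Ck k' Omega (dt g) & Ck k' Omega (dx g)]
   else True).

Fixpoint bounded_upto (k : nat) Omega g : Prop :=
  (exists M : R, forall p, Omega p -> `|g p.1 p.2| <= M) /\
  (if k is k'.+1 then
     bounded_upto k' Omega (dt g) /\ bounded_upto k' Omega (dx g)
   else True).

Definition Ckb (k : nat) Omega g : Prop :=
  Ck k Omega g /\ bounded_upto k Omega g.

(* g is given on the whole plane; it belongs to C_c^oo(Omega) after extension
   by zero outside Omega. *)
Definition Ccinfty Omega g : Prop :=
  let supp := closure [set p : R * R | g p.1 p.2 != 0] in
  [/\ forall k, Ck k Omega g, compact supp & supp `<=` Omega].

Definition smooth f : Prop :=
  forall (n : nat) (x : R), derivable (derive1n n f) x 1.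

Definition halfplane : set (R * R) := [set p | 0 < p.1].

End Regularity.

Section CauchyProblem.
Context {R : realType}.
Local Notation mu := (@lebesgue_measure R).
Implicit Types (f eta : R -> R) (u : R -> R -> R).

(* u is a priori a function on t > 0, so the initial condition is read both as
   the value at t = 0 and as the limit t -> 0+, which ties it to the values for
   positive times. *)
Definition cauchy_solution (alpha eps : R) f (u0 : R -> R) u : Prop :=
  (forall t x, 0 < t ->
     dt u t x + dx (fun s y => f (u s y)) t x
     = eps * dx (fun s => Dleft alpha (u s)) t x) /\
  (forall x, u 0 x = u0 x /\ u t x @[t --> 0^'+] --> u0 x).

Definition oriented_integral (h : R -> R) (a b : R) : R :=
  if a <= b then \int[mu]_(z in `[a, b]) h z else - \int[mu]_(z in `[b, a]) h z.

Definition entropy_flux f eta (v : R) : R :=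
  derive1 f v * eta v - derive1 f 0 * eta 0
  - oriented_integral (fun z => derive1n 2 f z * eta z) 0 v.

End CauchyProblem.

(* Main.v *)
Require Import Defs.
From HB Require Import structures.
From mathcomp Require Import all_boot all_order all_algebra.
From mathcomp Require Import all_classical all_reals all_analysis.
From mathcomp Require Import measurable_realfun ring lra.

Import Order.TTheory GRing.Theory Num.Theory.
Import numFieldNormedType.Exports.

Local Open Scope classical_set_scope.
Local Open Scope ring_scope.

Set Implicit Arguments.
Unset Strict Implicit.
Unset Printing Implicit Defensive.

Local Notation mu := lebesgue_measure.

(** Integrating by parts, the left derivative of a bounded function is, up to a
    nonnegative constant, the absolutely convergent integral of
    [(u x - u (x - s)) * s ^ (- a - 1)] over [s > 0], so its derivative in [x] is
    the same integral with [u^`()] in place of [u]; similarly for the right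
    derivative, and the two are exchanged by Fubini when integrated against a
    test function. If [e] is convex with a locally Lipschitz derivative, the
    nonlocal operator [L] so obtained satisfies [L (e u) >= e' (u) * L u]: the
    difference is the integral of a convexity gap against a positive kernel.
    Multiplying the equation by [e' (u) * phi] therefore bounds the space integral
    of the entropy inequality from below by the time derivative of the space
    integral of [e (u) * phi], which has compact support in time. A convex [eta]
    is a locally uniform limit of its Steklov means, and both sides depend
    continuously on [eta] in this sense. *)

(** * Real functions and their integrals *)

(** Two obstacles shape the estimates. The fractional derivative of a test function has tails on the
    whole line, so compact support alone does not make the nonlocal term integrable; one integrable
    majorant of the double integrand, depending on the test function only through a bound [M] and a
    radius [r], serves both for Fubini and for error constants uniform in time. Moreover the outer
    time integral is real-valued, and measurability in time of the space integral is not
    established: it is compared with an explicit integrable minorant through positive and negative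
    parts, and the remaining possibility, the default value 0, satisfies the inequality. The local
    Lipschitz bound on e' makes the convexity gap O(s^2), which beats s^(-a-1) because a < 1. For a
    Steklov mean of width h this Lipschitz constant grows like 1/h, but it only secures convergence;
    the error in the entropy is at most a constant times h. *)

Lemma is_derive_change (R : realType) (f g : R -> R) (x df dg : R) :
  is_derive x 1 f df -> f =1 g -> df = dg -> is_derive x 1 g dg.
Proof. by move=> + /funext <- <-. Qed.

Lemma is_derive_continuous (R : realType) (W w : R -> R) :
  (forall x : R, is_derive x 1 W (w x)) -> continuous W.
Proof.
move=> dW x; apply: differentiable_continuous.
by apply/derivable1_diffP; case: (dW x).
Qed.

Lemma derive_lipschitz (R : realType) (W w : R -> R) (M : R) :
  (forall x : R, is_derive x 1 W (w x)) -> (forall x, `|w x| <= M) ->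
  forall x y, `|W x - W y| <= M * `|x - y|.
Proof.
move=> dW wM; wlog : / forall x y, y <= x -> `|W x - W y| <= M * `|x - y|.
  apply=> x y yx.
  have [|c _ ->] := @MVT_segment R W w y x yx.
  by apply: continuous_subspaceT; exact: is_derive_continuous dW.
  by rewrite normrM ler_wpM2r.
move=> H x y; have [/H//|/ltW/H] := leP y x.
by rewrite distrC [`|y - x|]distrC.
Qed.

Lemma lipschitz_continuous (R : realType) (W : R -> R) (M : R) :
  (forall x y, `|W x - W y| <= M * `|x - y|) -> continuous W.
Proof.
move=> WM x; have M0 : 0 <= M.
  by have := WM 1 0; rewrite subr0 normr1 mulr1; exact: le_trans.
apply/cvgrPdist_le => /= e e0; near=> y.
apply: le_trans (WM _ _) _.
rewrite (@le_trans _ _ (M * (e / (M + 1))))//.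
  rewrite ler_wpM2l//; near: y.
  by apply: cvgr_dist_le; [exact: cvg_id|rewrite divr_gt0// ltr_wpDl].
have M1 : 0 < M + 1 by rewrite ltr_wpDl.
by rewrite mulrA ler_pdivrMr// mulrC ler_wpM2l ?(ltW e0)// lerDl.
Unshelve. all: by end_near. Qed.

Lemma FTC2_is_derive (R : realType) (F f : R -> R) (a b : R) : a < b ->
  {in `[a, b], forall x : R, is_derive x 1 F (f x)} ->
  {in `[a, b], forall x, {for x, continuous f}} ->
  mu.-integrable `[a, b] (EFin \o f) /\ \int[mu]_(x in `[a, b]) f x = F b - F a.
Proof.
move=> ab dF cf.
have cf' : {within `[a, b], continuous f}.
  by apply: continuous_in_subspaceT => x /set_mem; exact: cf.
split.
  by apply: continuous_compact_integrable => //; exact: segment_compact.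
rewrite /Rintegral (@continuous_FTC2 R f F a b) ?EFinB//.
- have cF x : x \in `[a, b] -> {for x, continuous F}.
    move=> xab; apply: differentiable_continuous.
    by apply/derivable1_diffP; case: (dF _ xab).
  split.
  + by move=> x /subset_itv_oo_cc xab; case: (dF _ xab).
  + by apply: cvg_at_right_filter; apply: cF; rewrite in_itv/= lexx ltW.
  + by apply: cvg_at_left_filter; apply: cF; rewrite in_itv/= lexx ltW.
- by move=> x /subset_itv_oo_cc xab; rewrite derive1E; case: (dF _ xab).
Qed.


Lemma RintegrableD d (T : measurableType d) (R : realType)
    (m : {measure set T -> \bar R}) (D : set T) (f g : T -> R) :
  measurable D -> m.-integrable D (EFin \o f) -> m.-integrable D (EFin \o g) ->
  m.-integrable D (EFin \o (fun x => f x + g x)).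
Proof.
by move=> mD fi gi; have := integrableD mD fi gi; apply: eq_integrable.
Qed.

Lemma RintegrableB d (T : measurableType d) (R : realType)
    (m : {measure set T -> \bar R}) (D : set T) (f g : T -> R) :
  measurable D -> m.-integrable D (EFin \o f) -> m.-integrable D (EFin \o g) ->
  m.-integrable D (EFin \o (fun x => f x - g x)).
Proof.
by move=> mD fi gi; have := integrableB mD fi gi; apply: eq_integrable.
Qed.

Lemma RintegrableZl d (T : measurableType d) (R : realType)
    (m : {measure set T -> \bar R}) (D : set T) (k : R) (f : T -> R) :
  measurable D -> m.-integrable D (EFin \o f) ->
  m.-integrable D (EFin \o (fun x => k * f x)).
Proof.
by move=> mD fi; have := integrableZl mD k fi; apply: eq_integrable.
Qed.

(** * The fractional kernel *)

(** Monotone convergence along the truncations of [g] to [A n]. It serves for power functions, whose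
    truncated integrals are computed from a primitive. *)
Lemma ge0_integrable_exhaustion (R : realType) (g : R -> R)
    (A : (set R)^nat) (C : R) :
  measurable_fun setT g -> (forall x, 0 <= g x) ->
  (forall n, measurable (A n)) -> nondecreasing_seq A ->
  (forall x, g x != 0 -> exists n, A n x) ->
  (forall n, \int[mu]_(x in A n) (g x)%:E <= C%:E)%E ->
  mu.-integrable setT (EFin \o g).
Proof.
move=> mg g0 mA ndA gA intC; apply/integrableP; split.
  exact/measurable_EFinP.
under eq_integral do rewrite gee0_abs ?lee_fin//.
suff : (\int[mu]_x (g x)%:E <= C%:E)%E by move/le_lt_trans; apply; rewrite ltry.
pose g_ n x := ((g x)%:E * (\1_(A n) x)%:E)%E.
have g_E n : (\int[mu]_x g_ n x = \int[mu]_(x in A n) (g x)%:E)%E.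
  by rewrite [RHS]integral_mkcond; apply: eq_integral => x _; rewrite epatch_indic.
have g_nd x : nondecreasing_seq (g_ ^~ x).
  move=> n m nm; rewrite /g_ lee_wpmul2l// ?lee_fin//.
  have [xn|/negP xn] := boolP (x \in A n); last first.
    by rewrite indicE (negbTE (introN idP xn)).
  rewrite !indicE xn; have /subsetPset sub := ndA _ _ nm.
  by rewrite mem_set//; apply: sub; exact: set_mem.
have -> : (\int[mu]_x (g x)%:E = \int[mu]_x limn (g_ ^~ x))%E.
  apply: eq_integral => x _; apply/esym/cvg_lim => //.
  have [gx0|/gA[N ANx]] := eqVneq (g x) 0.
    rewrite gx0 /g_ gx0; under eq_fun do rewrite mul0e; exact: cvg_cst.
  apply: cvg_near_cst; exists N => // n /= Nn; rewrite /g_ indicE mem_set ?mule1//.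
  by have /subsetPset := ndA _ _ Nn; apply.
have mg_ n : measurable_fun setT (g_ n).
  apply: emeasurable_funM; first exact/measurable_EFinP.
  by apply/measurable_EFinP; apply: measurable_indic.
have g_ge0 n x : (0 <= g_ n x)%E by rewrite /g_ mule_ge0// lee_fin.
rewrite monotone_convergence//.
apply: lime_le.
  apply: ereal_nondecreasing_is_cvgn => n m nm; apply: ge0_le_integral => //.
  - exact: mg_.
  - exact: mg_.
  - by move=> x _; exact: g_nd.
by apply: nearW => n; rewrite g_E.
Qed.

(** Dominated convergence with majorant |g|. Asking for eventual membership only where [g] is
    nonzero lets the sets omit the half-line on which the kernel vanishes. *)
Lemma Rintegral_cvg_exhaustion (R : realType) (g : R -> R)
    (A : (set R)^nat) :
  mu.-integrable setT (EFin \o g) -> (forall n, measurable (A n)) ->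
  (forall x, g x != 0 -> \forall n \near \oo, A n x) ->
  \int[mu]_(x in A n) g x @[n --> \oo] --> \int[mu]_x g x.
Proof.
move=> ig mA gA; apply: fine_cvg.
rewrite fineK; last exact: integrable_fin_num.
under eq_fun do rewrite integral_mkcond.
have mg := measurable_int mu ig.
have mgn n : measurable_fun setT ((EFin \o g) \_ (A n)).
  apply/(measurable_restrictT _ _).1 => //; exact: measurable_funTS.
apply: (@dominated_cvg _ _ _ mu _ _ _ _ (fun x => `|(g x)%:E|)%E) => //.
- move=> x _ /=; have [gx0|gx] := eqVneq (g x) 0.
    rewrite gx0; under eq_fun do rewrite patchE/= gx0 if_same; exact: cvg_cst.
  apply: cvg_near_cst; near=> n; rewrite patchE mem_set//.
  by near: n; exact: gA.
- by move/integrable_abse: ig.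
- by move=> n x _; rewrite patchE; case: ifP => //=; rewrite normr0 lee_fin.
Unshelve. all: by end_near. Qed.

(* The indicator discards the junk value [s `^ p = 1] for [s < 0]. *)
Definition ker (R : realType) (a s : R) : R :=
  s `^ (- (a + 1)) * \1_(`]0, +oo[%classic : set R) s.

Lemma ker_gt0E (R : realType) (a s : R) : 0 < s -> ker a s = s `^ (- (a + 1)).
Proof. by move=> s0; rewrite /ker indicE mem_set ?mulr1//= in_itv/= s0. Qed.

Lemma ker_le0E (R : realType) (a s : R) : s <= 0 -> ker a s = 0.
Proof.
move=> s0; rewrite /ker indicE memNset ?mulr0//= in_itv/= andbT.
by apply/negP; rewrite -leNgt.
Qed.

Lemma ker_ge0 (R : realType) (a s : R) : 0 <= ker a s.
Proof. by rewrite /ker mulr_ge0// powR_ge0. Qed.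

Lemma measurable_ker (R : realType) (a : R) : measurable_fun setT (ker a).
Proof.
apply: measurable_funM; first exact: measurable_powR.
exact: measurable_indic.
Qed.
Hint Extern 0 (measurable_fun _ (ker _)) => exact: measurable_ker : core.

Lemma mulr_powR (R : realType) (p x : R) : 0 < x -> x * x `^ p = x `^ (1 + p).
Proof.
move=> x0; have H : (1 + p == 0) ==> (x != 0) by rewrite (gt_eqF x0) implybT.
by rewrite (powRD H) powRr1// ltW.
Qed.

Lemma is_derive_powR_scaled (R : realType) (p q x : R) : p != 0 -> 0 < x ->
  q = p - 1 -> is_derive x 1 (fun s => p^-1 * s `^ p) (x `^ q).
Proof.
move=> p0 x0 ->; have dp := is_derive1_powR p x0.
have := is_deriveZ p^-1 dp; rewrite /GRing.scale/= mulrA mulVf// mul1r.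
exact.
Qed.

Lemma continuous_powR_gt0 (R : realType) (p x : R) : 0 < x ->
  {for x, continuous (fun s => s `^ p)}.
Proof.
move=> x0; apply: differentiable_continuous; apply/derivable1_diffP.
by case: (is_derive1_powR p x0).
Qed.

(** Below 1 the product is s^(-a), integrable at 0 because a < 1; above 1 it is s^(-a-1), integrable
    at infinity because a > 0. It is the common majorant for increments of bounded Lipschitz
    functions, which are O(min(1, s)). *)
Lemma integrable_min_ker (R : realType) (a : R) : 0 < a < 1 ->
  mu.-integrable setT (EFin \o (fun s => Num.min 1 s * ker a s)).
Proof.
move=> /andP[a0 a1].
pose I1 : set R := `]0, 1]%classic; pose I2 : set R := `[1, +oo[%classic.
have mI1 : measurable (I1 : set (measurableTypeR R)) by exact: measurable_itv.
have mI2 : measurable (I2 : set (measurableTypeR R)) by exact: measurable_itv.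
pose g1 (s : R) := s `^ (- a) * \1_I1 s.
pose g2 (s : R) := s `^ (- (a + 1)) * \1_I2 s.
have mg1 : measurable_fun setT g1.
  by apply: measurable_funM => //; exact: measurable_indic.
have mg2 : measurable_fun setT g2.
  by apply: measurable_funM => //; exact: measurable_indic.
(* The uniform bound 1/(1 - a) is the value of the full integral of s^(-a) over (0, 1]; for [g2]
   below, 1/a plays the same part. *)
have i1 : mu.-integrable setT (EFin \o g1).
  apply: (@ge0_integrable_exhaustion _ _ (fun n => `[n.+1%:R^-1, 1]%classic)
    (1 - a)^-1) => //.
  - by move=> x; rewrite /g1 mulr_ge0// powR_ge0.
  - move=> n m nm; apply/subsetPset => x /=; rewrite !in_itv/= => /andP[+ ->].
    rewrite andbT; apply: le_trans.
    by rewrite lef_pV2 ?posrE// ler_nat.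
  - move=> x; rewrite /g1 mulf_eq0 negb_or => /andP[_].
    rewrite indicE pnatr_eq0 eqb0 negbK inE /I1/= in_itv/= => /andP[x0 x1].
    exists (Num.truncn x^-1); rewrite in_itv/= x1 andbT invf_ple ?posrE//.
    by rewrite ltW// truncnS_gt.
  (* For n = 0 the truncation is the single point 1, whereas [FTC2_is_derive] asks for a
     nondegenerate interval. *)
  - case=> [|n].
      rewrite invr1 set_itv1 integral_set1 lee_fin invr_ge0 subr_ge0.
      exact: ltW.
    have n1 : (n.+2%:R : R)^-1 < 1 by rewrite invf_lt1 ?ltr1n.
    have pos x : x \in `[(n.+2%:R : R)^-1, 1] -> 0 < x.
      by rewrite in_itv/= => /andP[+ _]; apply: lt_le_trans; rewrite invr_gt0.
    have [] := @FTC2_is_derive R (fun s => (1 - a)^-1 * s `^ (1 - a))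
      (fun s => s `^ (- a)) n.+2%:R^-1 1 n1.
    + move=> x /pos x0; apply: is_derive_powR_scaled => //; last by ring.
      by rewrite subr_eq0 gt_eqF.
    + by move=> x /pos x0; exact: continuous_powR_gt0.
    + move=> /integrable_fin_num fin eI.
      rewrite (eq_integral (fun x : measurableTypeR R => (x `^ (- a))%:E)).
        rewrite -[leLHS]fineK//; last exact: fin.
        rewrite lee_fin [leLHS]eI powR1 mulr1 gerDl oppr_le0 mulr_ge0//.
        by rewrite invr_ge0 subr_ge0 ltW.
      move=> x /set_mem/= xI; rewrite /g1 indicE mem_set ?mulr1//.
      by rewrite /I1/= in_itv/= pos//=; move: xI; rewrite in_itv/= => /andP[].
have i2 : mu.-integrable setT (EFin \o g2).
  apply: (@ge0_integrable_exhaustion _ _ (fun n => `[1, n.+1%:R]%classic)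
    a^-1) => //.
  - by move=> x; rewrite /g2 mulr_ge0// powR_ge0.
  - move=> n m nm; apply/subsetPset => x /=; rewrite !in_itv/= => /andP[->]/=.
    by move=> /le_trans; apply; rewrite ler_nat.
  - move=> x; rewrite /g2 mulf_eq0 negb_or => /andP[_].
    rewrite indicE pnatr_eq0 eqb0 negbK inE /I2/= in_itv/= andbT => x1.
    by exists (Num.truncn x); rewrite in_itv/= x1/= ltW// truncnS_gt.
  - case=> [|n].
      by rewrite set_itv1 integral_set1 lee_fin invr_ge0 ltW.
    have n1 : 1 < n.+2%:R :> R by rewrite ltr1n.
    have pos x : x \in `[1, (n.+2%:R : R)] -> 0 < x.
      by rewrite in_itv/= => /andP[+ _]; apply: lt_le_trans.
    have [] := @FTC2_is_derive R (fun s => (- a)^-1 * s `^ (- a))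
      (fun s => s `^ (- (a + 1))) 1 n.+2%:R n1.
    + move=> x /pos x0; apply: is_derive_powR_scaled => //; last by ring.
      by rewrite oppr_eq0 gt_eqF.
    + by move=> x /pos x0; exact: continuous_powR_gt0.
    + move=> /integrable_fin_num fin eI.
      rewrite (eq_integral (fun x : measurableTypeR R => (x `^ (- (a + 1)))%:E)).
        rewrite -[leLHS]fineK//; last exact: fin.
        rewrite lee_fin [leLHS]eI powR1 mulr1 invrN mulNr opprK gerDr oppr_le0.
        by rewrite mulr_ge0// ?powR_ge0// invr_ge0 ltW.
      move=> x /set_mem/= xI; rewrite /g2 indicE mem_set ?mulr1//.
      by rewrite /I2/= in_itv/= andbT; move: xI; rewrite in_itv/= => /andP[].
apply: (@le_integrable _ _ _ mu _ _ _ ((EFin \o g1) \+ (EFin \o g2))%E) => //.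
- apply/measurable_EFinP; apply: measurable_funM => //.
  by apply: measurable_minr.
- move=> x _; have g0 : 0 <= g1 x + g2 x.
    by rewrite addr_ge0// mulr_ge0// powR_ge0.
  rewrite /= lee_fin [leRHS]ger0_norm//.
  have [x0|x0] := leP x 0; first by rewrite ker_le0E// mulr0 normr0.
  rewrite ger0_norm; last by rewrite mulr_ge0 ?ker_ge0// le_min ler01 (ltW x0).
  rewrite ker_gt0E// /g1 /g2; have [x1|x1] := leP x 1.
    rewrite [X in _ * X + _]indicE mem_set ?mulr1; last first.
      by rewrite /I1/= in_itv/= x0.
    rewrite mulr_powR// (_ : 1 - (a + 1) = - a); last by ring.
    rewrite lerDl.
    by rewrite mulr_ge0// powR_ge0.
  rewrite [X in _ + _ * X]indicE mem_set ?mulr1; last first.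
    by rewrite /I2/= in_itv/= ltW.
  by rewrite mul1r lerDr mulr_ge0// powR_ge0.
- exact: integrableD.
Qed.

Lemma integrable_ker_dominated (R : realType) (a M : R) (h : R -> R) :
  0 < a < 1 -> measurable_fun setT h ->
  (forall s : R, 0 < s -> `|h s| <= M * Num.min 1 s) ->
  mu.-integrable setT (EFin \o (fun s => h s * ker a s)).
Proof.
move=> a01 mh hM.
apply: (@le_integrable _ _ _ mu _ _ _
    (fun s => M%:E * (Num.min 1 s * ker a s)%:E)%E) => //.
- by apply/measurable_EFinP; apply: measurable_funM.
- move=> s _ /=; rewrite lee_fin.
  have [s0|s0] := leP s 0; first by rewrite ker_le0E// !mulr0 normr0.
  rewrite normrM [leRHS]ger0_norm; last first.
    by rewrite mulrA mulr_ge0 ?ker_ge0// (le_trans _ (hM _ s0)).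
  by rewrite mulrA (ger0_norm (ker_ge0 _ _)) ler_wpM2r ?ker_ge0// hM.
- by apply: integrableZl => //; exact: integrable_min_ker.
Qed.

(** * Changes of variable and improper integrals *)

Lemma integrable_subset (R : realType) (D : set R) (f : R -> R) :
  measurable D -> mu.-integrable setT (EFin \o f) ->
  mu.-integrable D (EFin \o f).
Proof. by move=> mD fi; apply: (integrableS _ _ _ fi). Qed.

Definition measure_preserving (R : realType) (phi : R -> R) : Prop :=
  measurable_fun setT phi /\
  forall A : set R, measurable A -> mu (phi @^-1` A) = mu A.

(** The pushforward agrees with Lebesgue measure on the intervals that are open on the left and
    closed on the right, and uniqueness of the measure does the rest. *)
Lemma measure_preserving_shift (R : realType) (c : R) :
  measure_preserving (fun s : R => s + c).
Proof.
have mphi : measurable_fun setT (fun s : R => s + c).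
  by apply: measurable_funD => //; exact: measurable_cst.
split=> // A mA.
suff /(_ A mA) : forall A, measurable A ->
  mu A = pushforward mu ((fun s : R => s + c) : _ -> measurableTypeR R) A by [].
apply: lebesgue_measure_unique => // _ [[a b]] _ <-.
rewrite /= /pushforward /= (_ : _ @^-1` _ = `]a - c, b - c]%classic); last first.
  by apply/seteqP; split => x /=; rewrite !in_itv/= ltrBlDr lerBrDr.
rewrite !lebesgue_measure_itv/= ?lebesgue_measure_itv/= !lte_fin ltrD2r.
by case: ifP => // _; rewrite -!EFinD; congr (_%:E); ring.
Qed.

Lemma measure_preserving_reflect (R : realType) (c : R) :
  measure_preserving (fun s : R => c - s).
Proof.
have mphi : measurable_fun setT (fun s : R => c - s).
  by apply: measurable_funB => //; exact: measurable_cst.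
split=> // A mA.
suff /(_ A mA) : forall A, measurable A ->
  mu A = pushforward mu ((fun s : R => c - s) : _ -> measurableTypeR R) A by [].
apply: lebesgue_measure_unique => // _ [[a b]] _ <-.
(* Reflection swaps the open and the closed end; the length is unchanged. *)
rewrite /= /pushforward /= (_ : _ @^-1` _ = `[c - b, c - a[%classic); last first.
  by apply/seteqP; split => x /=; rewrite !in_itv/= ltrBrDr ltrBrDl lerBlDr lerBlDl andbC addrC.
rewrite !lebesgue_measure_itv/= ?lebesgue_measure_itv/= !lte_fin ltrD2l ltrN2.
by case: ifP => // _; rewrite -!EFinD; congr (_%:E); ring.
Qed.

Lemma integral_measure_preserving (R : realType) (phi h : R -> R) (D : set R) :
  measure_preserving phi -> measurable D -> measurable_fun setT h ->
  mu.-integrable (phi @^-1` D) (EFin \o (h \o phi)) ->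
  \int[mu]_(x in D) h x = \int[mu]_(x in phi @^-1` D) h (phi x).
Proof.
move=> [mphi muphi] mD mh ih; congr fine.
rewrite -(@integral_pushforward _ _ (measurableTypeR R) (measurableTypeR R) R phi mphi mu D (EFin \o h))//.
  by apply: eq_measure_integral => A mA _; rewrite -[LHS]muphi.
exact/measurable_EFinP.
Qed.

Lemma ge0_integral_measure_preserving (R : realType) (phi h : R -> R) :
  measure_preserving phi -> measurable_fun setT h -> (forall x, 0 <= h x) ->
  (\int[mu]_x (h (phi x))%:E = \int[mu]_x (h x)%:E)%E.
Proof.
move=> [mphi muphi] mh h0.
rewrite -[X in (\int[mu]_(x in X) _)%E = _](@preimage_setT _ _ phi).
rewrite -(@ge0_integral_pushforward _ _ (measurableTypeR R) (measurableTypeR R) R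
  phi mphi mu setT (EFin \o h))//.
- by apply: eq_measure_integral => A mA _; rewrite -[RHS]muphi.
- exact/measurable_EFinP.
- by move=> x _; rewrite lee_fin.
Qed.

(** Once [h] is cut off at [S], the linear bound M s is at most M max(1, S) min(1, s), so the
    domination over the half-line applies. *)
Lemma integrable_ker_oc (R : realType) (a M S : R) (h : R -> R) :
  0 < a < 1 -> measurable_fun setT h ->
  (forall s : R, 0 < s -> `|h s| <= M * s) ->
  mu.-integrable `]0, S] (EFin \o (fun s => h s * ker a s)).
Proof.
move=> a01 mh hM.
have M0 : 0 <= M by have := hM 1 ltr01; rewrite mulr1; exact: le_trans.
pose J : set R := `]0, S]%classic.
have mJ : measurable J by exact: measurable_itv.
have : mu.-integrable setT (EFin \o (fun s => (h s * \1_J s) * ker a s)).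
  apply: (@integrable_ker_dominated _ _ (M * Num.max 1 S)) => //.
    by apply: measurable_funM => //; exact: measurable_indic.
  move=> s s0; rewrite indicE; have [/set_mem|] := boolP (s \in J); last first.
    by move=> _; rewrite mulr0 normr0 !mulr_ge0 ?le_min ?le_max ?ler01 ?(ltW s0).
  rewrite /J/= in_itv/= s0/= mulr1 => sS; apply: le_trans (hM _ s0) _.
  rewrite -mulrA ler_wpM2l//; have [s1|s1] := leP s 1.
    by rewrite ler_peMl ?(ltW s0)// le_max lexx.
  by rewrite mulr1 le_max sS orbT.
move=> /(integrable_subset mJ).
apply: eq_integrable => // s sJ /=; congr (_%:E).
by rewrite indicE sJ mulr1.
Qed.

(** The fundamental theorem on [1/(n+1), S], followed by the limit in n. The limit of [F] at 0 from
    the right is prescribed rather than its value there, since [F] will contain a negative power. *)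
Lemma improper_FTC2 (R : realType) (F f : R -> R) (S : R) : 0 < S ->
  (forall s : R, 0 < s -> is_derive s 1 F (f s)) ->
  (forall s : R, 0 < s -> {for s, continuous f}) ->
  mu.-integrable `]0, S] (EFin \o f) ->
  F s @[s --> 0^'+] --> 0 ->
  \int[mu]_(s in `]0, S]) f s = F S.
Proof.
move=> S0 dF cf fi F0; pose J : set R := `]0, S]%classic.
have mJ : measurable J by exact: measurable_itv.
have fiJ : mu.-integrable setT (EFin \o (f \_ J)).
  rewrite -restrict_EFin; apply/integrable_restrict => //.
  by rewrite setTI.
rewrite Rintegral_mkcond.
pose A n : set R := `[n.+1%:R^-1, S]%classic.
have mA n : measurable (A n) by exact: measurable_itv.
have harm : (n.+1%:R^-1 : R) @[n --> \oo] --> 0 by exact: cvg_harmonic.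
have := @Rintegral_cvg_exhaustion R (f \_ J) A fiJ mA.
have H x : (f \_ J) x != 0 -> \forall n \near \oo, A n x.
  rewrite patchE; case: ifPn => [/set_mem|]; last by rewrite eqxx.
  rewrite /J/= in_itv/= => /andP[x0 xS] _; near=> n.
  rewrite /A/= in_itv/= xS andbT; apply: ltW; near: n.
  exact: (cvgr_lt _ harm).
move=> /(_ H) cvg1; apply/esym.
rewrite -(cvg_lim (@Rhausdorff R) cvg1); apply/esym/cvg_lim => //.
have cvg2 : F S - F (n.+1%:R^-1) @[n --> \oo] --> F S.
  rewrite -[X in _ --> X]subr0; apply: cvgB; first exact: cvg_cst.
  move/cvg_at_rightP : F0; apply; split=> //.
apply: cvg_trans cvg2; apply: near_eq_cvg; near=> n.
have nS : (n.+1%:R^-1 : R) < S by near: n; exact: (cvgr_lt _ harm).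
have pos s : s \in `[(n.+1%:R : R)^-1, S] -> 0 < s.
  by rewrite in_itv/= => /andP[+ _]; apply: lt_le_trans; rewrite invr_gt0.
have [|s /pos|_ <-] := @FTC2_is_derive R F f _ _ nS.
- by move=> s /pos; exact: dF.
- exact: cf.
- apply: eq_Rintegral => s /set_mem/= sA; rewrite patchE mem_set//.
  by rewrite /J/= in_itv/= pos//; move: sA; rewrite in_itv/= => /andP[].
Unshelve. all: by end_near. Qed.

Lemma continuous_ker (R : realType) (a s : R) : 0 < s ->
  {for s, continuous (ker a)}.
Proof.
move=> s0; apply: (@cvg_trans _ (x `^ (- (a + 1)) @[x --> s])).
  apply: near_eq_cvg; near=> x; rewrite ker_gt0E//.
  by near: x; exact: lt_nbhsr.
by rewrite ker_gt0E//; exact: continuous_powR_gt0.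
Unshelve. all: by end_near. Qed.

Lemma mulr_ker (R : realType) (a s : R) : 0 < s -> s * ker a s = s `^ (- a).
Proof. by move=> s0; rewrite ker_gt0E// mulr_powR//; congr (_ `^ _); ring. Qed.

Lemma is_derive_powR_ker (R : realType) (a s : R) : 0 < s ->
  is_derive s 1 (fun x => x `^ (- a)) (- a * ker a s).
Proof.
move=> s0; have := is_derive1_powR (- a) s0.
by rewrite ker_gt0E// (_ : - a - 1 = - (a + 1))//; ring.
Qed.

Lemma powR_cvg0_dominated (R : realType) (F : R -> R) (M p : R) : 0 < p ->
  (forall s : R, 0 < s -> `|F s| <= M * s `^ p) -> F s @[s --> 0^'+] --> 0.
Proof.
move=> p0 FM; apply: norm_cvg0.
have cM : M * s `^ p @[s --> 0^'+] --> 0.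
  rewrite -[X in _ --> X](mulr0 M); apply: cvgM; [exact: cvg_cst|exact: powR_cvg0].
apply: (@squeeze_cvgr _ _ _ _ (cst 0) _ _ _ _ _ cM); last exact: cvg_cst.
near=> s; rewrite normr_ge0/= FM//; near: s; exact: nbhs_right_gt.
Unshelve. all: by end_near. Qed.

(** Integration by parts with the primitive P(s) - P(0), normalized at 0 so that its product with
    s^(-a) is O(s^(1-a)) and leaves no boundary term there; differentiating s^(-a) produces the
    kernel. *)
Lemma integral_frac_kernel (R : realType) (a M S : R) (P p : R -> R) :
  0 < a < 1 -> (forall s : R, is_derive s 1 P (p s)) ->
  (forall s, `|p s| <= M) -> continuous p -> 0 < S ->
  \int[mu]_(s in `]0, S[) (p s / s `^ a) =
  (P S - P 0) * S `^ (- a) + a * \int[mu]_(s in `]0, S]) ((P s - P 0) * ker a s).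
Proof.
move=> a01 dP pM cp S0; have /andP[a0 a1] := a01.
have PM (s : R) : 0 < s -> `|P s - P 0| <= M * s.
  move=> s0; apply: le_trans (derive_lipschitz dP pM s 0) _.
  by rewrite subr0 (ger0_norm (ltW s0)).
have cP := is_derive_continuous dP.
(* This is the integrand p(s) s^(-a): moving one factor s to [p] exhibits the linear bound required
   by [integrable_ker_oc]. *)
have i1 : mu.-integrable `]0, S] (EFin \o (fun s => (s * p s) * ker a s)).
  apply: (@integrable_ker_oc _ _ M) => //.
    apply: measurable_funM => //; exact: continuous_measurable_fun.
  by move=> s s0; rewrite normrM (ger0_norm (ltW s0)) mulrC ler_wpM2r ?(ltW s0).
have i2 : mu.-integrable `]0, S] (EFin \o (fun s => (P s - P 0) * ker a s)).
  apply: (@integrable_ker_oc _ _ M) => //.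
  apply: measurable_funB => //; exact: continuous_measurable_fun.
have i3 : mu.-integrable `]0, S] (EFin \o (fun s => a * ((P s - P 0) * ker a s))).
  exact: RintegrableZl.
pose F s := (P s - P 0) * s `^ (- a).
pose f s := (s * p s) * ker a s - a * ((P s - P 0) * ker a s).
have F0 : F s @[s --> 0^'+] --> 0.
  apply: (@powR_cvg0_dominated _ _ M (1 - a)); first by rewrite subr_gt0.
  move=> s s0; rewrite normrM (ger0_norm (powR_ge0 _ _)).
  by rewrite -mulr_powR// mulrA ler_wpM2r ?powR_ge0// PM.
have dF (s : R) : 0 < s -> is_derive s 1 F (f s).
  move=> s0; have := is_deriveM (is_deriveB (dP s) (is_derive_cst (P 0) s 1))
    (@is_derive_powR_ker R a s s0).
  move/is_derive_change; apply=> //; rewrite /GRing.scale/= /f -mulr_ker//.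
  by rewrite !fctE/=; ring.
have cf (s : R) : 0 < s -> {for s, continuous f}.
  move=> s0; have ck := @continuous_ker R a s s0.
  apply: cvgB.
    by apply: cvgM => //; apply: cvgM; [exact: cvg_id|exact: cp].
  apply: cvgM; first exact: cvg_cst.
  apply: cvgM => //; apply: cvgB; [exact: cP|exact: cvg_cst].
have fi : mu.-integrable `]0, S] (EFin \o f).
  exact: RintegrableB.
have := improper_FTC2 S0 dF cf fi F0.
rewrite RintegralB// RintegralZl// => /eqP; rewrite subr_eq => /eqP <-.
rewrite -Rintegral_itv_bndo_bndc; last first.
  by apply: (integrableS _ _ _ i1) => // s /=; rewrite !in_itv/= => /andP[-> /ltW].
apply: eq_Rintegral => s /set_mem/=; rewrite in_itv/= => /andP[s0 _].
by rewrite mulrAC mulr_ker// powRN mulrC.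
Qed.

(** The boundary term is at most 2 M S^(-a) because [P] is bounded, hence vanishes in the limit, and
    the remaining kernel integral converges absolutely. So the improper limit exists even where [p]
    divided by s^a is not integrable at infinity. *)
Lemma cvg_frac_kernel (R : realType) (a M : R) (P p : R -> R) :
  0 < a < 1 -> (forall s : R, is_derive s 1 P (p s)) ->
  (forall s, `|P s| <= M) -> (forall s, `|p s| <= M) -> continuous p ->
  \int[mu]_(s in `]0, S[) (p s / s `^ a) @[S --> +oo] -->
  a * \int[mu]_s ((P s - P 0) * ker a s).
Proof.
move=> a01 dP PM pM cp; have /andP[a0 a1] := a01.
have cP := is_derive_continuous dP.
have iP : mu.-integrable setT (EFin \o (fun s => (P s - P 0) * ker a s)).
  apply: (@integrable_ker_dominated _ _ (M + M)) => //.
    apply: measurable_funB => //; exact: continuous_measurable_fun.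
  move=> s s0; have [s1|s1] := leP s 1.
    apply: le_trans (derive_lipschitz dP pM s 0) _.
    rewrite subr0 (ger0_norm (ltW s0)) ler_wpM2r ?(ltW s0)// lerDl.
    by rewrite (le_trans _ (PM 0)).
  by rewrite mulr1 (le_trans (ler_normB _ _))// lerD.
apply/cvg_pinftyP => u uy.
have cF : (P (u n) - P 0) * u n `^ (- a) @[n --> \oo] --> 0.
  apply: norm_cvg0.
  have cM : (M + M) * (u n)^-1 `^ a @[n --> \oo] --> 0.
    rewrite -[X in _ --> X](mulr0 (M + M)); apply: cvgMr.
    have uV : (u n)^-1 @[n --> \oo] --> 0^'+.
      have u0 : \forall n \near \oo, 0 < u n by move/cvgryPgt : uy; exact.
      have uV0 : (u n)^-1 @[n --> \oo] --> 0 by exact/gtr0_cvgV0.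
      move=> A [e /= e0 eA].
      have : \forall n \near \oo, A (u n)^-1; last exact.
      near=> n; apply: eA => /=.
        by near: n; move/cvgrPdist_lt : uV0 => /(_ _ e0); exact.
      by rewrite invr_gt0; near: n.
    exact: (cvg_comp _ _ uV (powR_cvg0 a0)).
  apply: (@squeeze_cvgr _ _ _ _ (cst 0) _ _ _ _ _ cM); last exact: cvg_cst.
  near=> n; rewrite normr_ge0/= normrM (ger0_norm (powR_ge0 _ _)).
  have u0 : 0 < u n by near: n; move/cvgryPgt : uy; exact.
  rewrite -[- a]mulN1r powRrM powR_inv1 ?(ltW u0)// ler_wpM2r ?powR_ge0//.
  by rewrite (le_trans (ler_normB _ _))// lerD.
have cI : \int[mu]_(s in `]0, u n]) ((P s - P 0) * ker a s) @[n --> \oo] -->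
    \int[mu]_s ((P s - P 0) * ker a s).
  apply: Rintegral_cvg_exhaustion => // x.
  rewrite mulf_eq0 negb_or => /andP[_ kx]; near=> n.
  rewrite /= in_itv/=; apply/andP; split.
    by apply: contraNT kx; rewrite -leNgt => /ker_le0E ->.
  by near: n; move/cvgryPge : uy; exact.
rewrite -[X in _ --> X]add0r.
apply: cvg_trans (cvgD cF (cvgM (cvg_cst a) cI)); apply: near_eq_cvg; near=> n.
have u0 : 0 < u n by near: n; move/cvgryPgt : uy; exact.
by rewrite (integral_frac_kernel a01 dP pM cp u0).
Unshelve. all: by end_near. Qed.

(** * The derivatives of the fractional derivatives *)

(* Up to the factor [dcoef a * a], the functions [ker_diff a 1 g^`()] and
   [- ker_diff a (-1) g^`()] are the derivatives of [Dright a g] and [Dleft a g]. *)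
Definition ker_diff (R : realType) (a sg : R) (g : R -> R) (x : R) : R :=
  \int[mu]_s ((g (x + sg * s) - g x) * ker a s).

(** One constant for both bounds keeps the statements to a single parameter. On this class
    [ker_diff] converges absolutely, increments over s > 0 being at most 2 M min(1, s). *)
Definition bounded_lipschitz (R : realType) (M : R) (g : R -> R) : Prop :=
  (forall x, `|g x| <= M) /\ (forall x y, `|g x - g y| <= M * `|x - y|).

Lemma bounded_lipschitz_continuous (R : realType) (M : R) (g : R -> R) :
  bounded_lipschitz M g -> continuous g.
Proof. by case=> _ /lipschitz_continuous. Qed.

Lemma bounded_lipschitz_measurable (R : realType) (M : R) (g : R -> R) :
  bounded_lipschitz M g -> measurable_fun setT g.
Proof.
by move=> /bounded_lipschitz_continuous; exact: continuous_measurable_fun.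
Qed.

Lemma bounded_lipschitz_ge0 (R : realType) (M : R) (g : R -> R) :
  bounded_lipschitz M g -> 0 <= M.
Proof. by case=> /(_ 0) + _; exact: le_trans. Qed.

Lemma derive_bounded_lipschitz (R : realType) (M : R) (W w : R -> R) :
  (forall x : R, is_derive x 1 W (w x)) ->
  (forall x, `|W x| <= M) -> (forall x, `|w x| <= M) -> bounded_lipschitz M W.
Proof. by move=> dW WM wM; split => //; exact: derive_lipschitz dW wM. Qed.

Lemma bounded_lipschitz_diff (R : realType) (M sg : R) (g : R -> R) :
  `|sg| <= 1 -> bounded_lipschitz M g ->
  forall x s : R, 0 < s -> `|g (x + sg * s) - g x| <= (M + M) * Num.min 1 s.
Proof.
move=> sg1 gM x s s0; have M0 := bounded_lipschitz_ge0 gM; case: gM => gM gL.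
have [s1|s1] := leP s 1.
  apply: le_trans (gL _ _) _.
  rewrite addrAC subrr add0r normrM (ger0_norm (ltW s0)) mulrDl.
  rewrite (@le_trans _ _ (M * s))//; last by rewrite lerDl mulr_ge0 ?(ltW s0).
  by rewrite ler_wpM2l// ler_piMl ?(ltW s0).
by rewrite mulr1 (le_trans (ler_normB _ _))// lerD.
Qed.

Lemma integrable_ker_diff (R : realType) (a M sg x : R) (g : R -> R) :
  0 < a < 1 -> `|sg| <= 1 -> bounded_lipschitz M g ->
  mu.-integrable setT (EFin \o (fun s => (g (x + sg * s) - g x) * ker a s)).
Proof.
move=> a01 sg1 gM; have cg := bounded_lipschitz_continuous gM.
apply: (@integrable_ker_dominated _ _ (M + M)) => //.
  apply: measurable_funB; last exact: measurable_cst.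
  apply: measurableT_comp; first exact: continuous_measurable_fun.
  apply: measurable_funD; first exact: measurable_cst.
  by apply: measurable_funM => //; exact: measurable_cst.
by move=> s s0; exact: bounded_lipschitz_diff.
Qed.

Lemma is_derive_comp_shift (R : realType) (W : R -> R) (x c dW : R) :
  is_derive (x + c) 1 W dW -> is_derive x 1 (fun y => W (y + c)) dW.
Proof.
move=> dWc; have dc : is_derive x 1 (fun y : R => y + c) 1.
  by apply: (is_derive_change (is_deriveD (is_derive_id x 1) (is_derive_cst c x 1))) => //; rewrite addr0.
have := @is_derive1_comp R W (fun y : R => y + c) x dW 1 dWc dc.
by rewrite mulr1.
Qed.

(** Differentiation under the integral sign: [w] is itself bounded and Lipschitz, so the
    differentiated integrand has the majorant 2 M min(1, s) times the kernel, independently of the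
    point. *)
Lemma is_derive_ker_diff (R : realType) (a M sg : R) (W w : R -> R) (x : R) :
  0 < a < 1 -> `|sg| <= 1 -> (forall x : R, is_derive x 1 W (w x)) ->
  bounded_lipschitz M W -> bounded_lipschitz M w ->
  is_derive x 1 (ker_diff a sg W) (ker_diff a sg w x).
Proof.
move=> a01 sg1 dW WM wM.
pose f (x s : R) := (W (x + sg * s) - W x) * ker a s.
pose G (s : R) := (M + M) * (Num.min 1 s * ker a s).
have df (y s : R) : is_derive y 1 (f ^~ s) ((w (y + sg * s) - w y) * ker a s).
  have dWs := @is_derive_comp_shift R W y (sg * s) _ (dW _).
  have := is_deriveM (is_deriveB dWs (dW y)) (is_derive_cst (ker a s) y 1).
  move/is_derive_change; apply => //.
  by rewrite scaler0 add0r /GRing.scale/= mulrC.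
have intf y : `]x - 1, x + 1[%classic y -> mu.-integrable setT (EFin \o f y).
  by move=> _; exact: integrable_ker_diff WM.
have derf (y s : R) : `]x - 1, x + 1[%classic y -> setT s -> derivable (f ^~ s) y 1.
  by move=> _ _; case: (df y s).
have iG : mu.-integrable setT (EFin \o G).
  by apply: RintegrableZl => //; exact: integrable_min_ker.
have M0 := bounded_lipschitz_ge0 WM.
have dfE (y s : R) : partial1of2 f y s = (w (y + sg * s) - w y) * ker a s.
  by rewrite partial1of2E; case: (df y s).
have fG (y s : R) : `]x - 1, x + 1[%classic y -> setT s -> `|partial1of2 f y s| <= `|G s|.
  move=> _ _; rewrite dfE /G.
  have [s0|s0] := leP s 0; first by rewrite ker_le0E// !mulr0 normr0.
  rewrite normrM [leRHS]ger0_norm; last first.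
    apply: mulr_ge0; first exact: addr_ge0.
    by rewrite mulr_ge0 ?ker_ge0// le_min ler01 ltW.
  rewrite mulrA (ger0_norm (ker_ge0 _ _)) ler_wpM2r ?ker_ge0//.
  exact: (bounded_lipschitz_diff sg1 wM).
have xI : `]x - 1, x + 1[%classic x by rewrite /= in_itv/= gtrBl ltrDl ltr01.
have iG' : mu.-integrable setT (EFin \o (fun s => `|G s|)).
  by have := integrable_abse iG; apply: eq_integrable.
have dk := @derivable_under_integral R _ _ mu f setT measurableT x _ _ xI intf derf
  (fun s => `|G s|) (fun s => normr_ge0 _) iG' fG.
have ek := @differentiation_under_integral R _ _ mu f setT measurableT x _ _ xI intf derf
  (fun s => `|G s|) (fun s => normr_ge0 _) iG' fG.
split; first exact: dk.
by rewrite -derive1E [LHS]ek; apply: eq_Rintegral => s _; rewrite dfE.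
Qed.

Lemma integrable_frac_kernel (R : realType) (a M S : R) (p : R -> R) :
  0 < a < 1 -> measurable_fun setT p -> (forall s, `|p s| <= M) ->
  mu.-integrable `]0, S[ (EFin \o (fun s => p s / s `^ a)).
Proof.
move=> a01 mp pM.
have i1 : mu.-integrable `]0, S] (EFin \o (fun s => (s * p s) * ker a s)).
  apply: (@integrable_ker_oc _ _ M) => //; first exact: measurable_funM.
  by move=> s s0; rewrite normrM (ger0_norm (ltW s0)) mulrC ler_wpM2r ?(ltW s0).
have : mu.-integrable `]0, S[ (EFin \o (fun s => (s * p s) * ker a s)).
  by apply: (integrableS _ _ _ i1) => // s /=; rewrite !in_itv/= => /andP[-> /ltW].
apply: eq_integrable => // s /set_mem/=; rewrite in_itv/= => /andP[s0 _].
by congr (_%:E); rewrite mulrAC mulr_ker// powRN mulrC.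
Qed.

(** The substitution z = s + x moves the singularity to 0 and turns the truncated integrals defining
    [Dright] into those of [cvg_frac_kernel], with upper limit b - x. *)
Lemma Dright_ker_diff (R : realType) (a M : R) (W w : R -> R) (x : R) :
  0 < a < 1 -> (forall x : R, is_derive x 1 W (w x)) ->
  bounded_lipschitz M W -> bounded_lipschitz M w ->
  Dright a W x = dcoef a * (a * ker_diff a 1 W x).
Proof.
move=> a01 dW WM wM; congr (_ * _); apply/cvg_lim => //.
rewrite (_ : derive1 W = w); last first.
  by apply/funext => z; rewrite derive1E; case: (dW z).
have dP (s : R) : is_derive s 1 (fun s => W (s + x)) (w (s + x)).
  exact: is_derive_comp_shift.
have cw := bounded_lipschitz_continuous wM.
have cp : continuous (fun s => w (s + x)).
  move=> s; apply: (@continuous_comp _ _ _ (fun s => s + x) w); last exact: cw.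
  by apply: cvgD; [exact: cvg_id|exact: cvg_cst].
have := @cvg_frac_kernel R a M _ _ a01 dP (fun s => WM.1 (s + x)) (fun s => wM.1 (s + x)) cp.
rewrite (_ : \int[mu]_s ((W (s + x) - W (0 + x)) * ker a s) = ker_diff a 1 W x); last first.
  by apply: eq_Rintegral => s _; rewrite mul1r add0r [x + s]addrC.
move=> /(cvg_comp _ _ (cvg_addrr (- x))).
apply: cvg_trans; apply: near_eq_cvg; near=> b => /=.
have pre : (fun s => s + x) @^-1` `]x, b[%classic = `]0, b - x[%classic :> set R.
  by apply/seteqP; split => z /=; rewrite !in_itv/= ltrDr ltrBrDr.
rewrite [RHS](integral_measure_preserving (measure_preserving_shift x)).
- by rewrite pre; apply: eq_Rintegral => s _; rewrite addrK.
- exact: measurable_itv.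
- rewrite (_ : (fun z => _) = (fun z => w z * (z - x) `^ (- a))); last first.
    by apply/funext => z; rewrite powRN.
  apply: measurable_funM; first exact: bounded_lipschitz_measurable wM.
  apply: (measurableT_comp (measurable_powR (- a))).
  by apply: measurable_funB => //; exact: measurable_cst.
- rewrite pre; have := @integrable_frac_kernel R a M (b - x) _ a01
    (continuous_measurable_fun cp) (fun s => wM.1 (s + x)).
  by apply: eq_integrable => // s _ /=; rewrite addrK.
Unshelve. all: by end_near. Qed.

Lemma Dleft_ker_diff (R : realType) (a M : R) (W w : R -> R) (x : R) :
  0 < a < 1 -> (forall x : R, is_derive x 1 W (w x)) ->
  bounded_lipschitz M W -> bounded_lipschitz M w ->
  Dleft a W x = - (dcoef a * (a * ker_diff a (-1) W x)).
Proof.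
move=> a01 dW WM wM; rewrite -mulrN; congr (_ * _); apply/cvg_lim => //.
rewrite (_ : derive1 W = w); last first.
  by apply/funext => z; rewrite derive1E; case: (dW z).
(* Under the reflection z = x - s the primitive of w(x - s) is -W(x - s); hence the minus sign in
   the conclusion. *)
have dP (s : R) : is_derive s 1 (fun s => - W (x - s)) (w (x - s)).
  have dr : is_derive s 1 (fun y : R => x - y) (-1).
    apply: (is_derive_change (is_deriveB (is_derive_cst x s 1) (is_derive_id s 1))) => //.
    by rewrite sub0r.
  have := is_deriveN (@is_derive1_comp R W (fun y : R => x - y) s _ _ (dW _) dr).
  by move/is_derive_change; apply => //; rewrite mulrN1 opprK.
have cw := bounded_lipschitz_continuous wM.
have cp : continuous (fun s => w (x - s)).
  move=> s; apply: (@continuous_comp _ _ _ (fun s => x - s) w); last exact: cw.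
  by apply: cvgB; [exact: cvg_cst|exact: cvg_id].
have WM' s : `|- W (x - s)| <= M by rewrite normrN WM.1.
have := @cvg_frac_kernel R a M _ _ a01 dP WM' (fun s => wM.1 (x - s)) cp.
rewrite (_ : \int[mu]_s ((- W (x - s) - - W (x - 0)) * ker a s) =
    - ker_diff a (-1) W x); last first.
  have sg1 : `|-1 : R| <= 1 by rewrite normrN1.
  rewrite /ker_diff -[RHS]mulN1r -RintegralZl//; last first.
    exact: integrable_ker_diff WM.
  by apply: eq_Rintegral => s _; rewrite subr0 (mulN1r s); ring.
rewrite mulrN.
have xy : x - b @[b --> -oo] --> +oo.
  by apply/cvgNy_compNP => /=; under eq_fun do rewrite opprK; exact: cvg_addrl.
move=> /(cvg_comp _ _ xy).
apply: cvg_trans; apply: near_eq_cvg; near=> b => /=.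
have pre : (fun s => x - s) @^-1` `]b, x[%classic = `]0, x - b[%classic :> set R.
  by apply/seteqP; split => z /=; rewrite !in_itv/= ltrBrDl gtrBl ltrBrDr addrC andbC addrC.
rewrite [RHS](integral_measure_preserving (measure_preserving_reflect x)).
- by rewrite pre; apply: eq_Rintegral => s _; rewrite subKr.
- exact: measurable_itv.
- rewrite (_ : (fun z => _) = (fun z => w z * (x - z) `^ (- a))); last first.
    by apply/funext => z; rewrite powRN.
  apply: measurable_funM; first exact: bounded_lipschitz_measurable wM.
  apply: (measurableT_comp (measurable_powR (- a))).
  by apply: measurable_funB => //; exact: measurable_cst.
- rewrite pre; have := @integrable_frac_kernel R a M (x - b) _ a01
    (continuous_measurable_fun cp) (fun s => wM.1 (x - s)).
  by apply: eq_integrable => // s _ /=; rewrite subKr.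
Unshelve. all: by end_near. Qed.

Lemma dx_Dright (R : realType) (a M : R) (g : R -> R -> R) (t x : R) (W w : R -> R) :
  0 < a < 1 -> g t = W -> (forall x : R, is_derive x 1 W (w x)) ->
  bounded_lipschitz M W -> bounded_lipschitz M w ->
  dx (fun s => Dright a (g s)) t x = dcoef a * a * ker_diff a 1 w x.
Proof.
move=> a01 gW dW WM wM; rewrite /dx gW.
have sg1 : `|1 : R| <= 1 by rewrite normr1.
have dk := is_derive_ker_diff x a01 sg1 dW WM wM.
rewrite (_ : Dright a W = (fun x => dcoef a * a * ker_diff a 1 W x)); last first.
  by apply/funext => y; rewrite (Dright_ker_diff _ a01 dW WM wM) mulrA.
by rewrite derive1E; case: (is_deriveZ (dcoef a * a) dk).
Qed.

Lemma dx_Dleft (R : realType) (a M : R) (g : R -> R -> R) (t x : R) (W w : R -> R) :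
  0 < a < 1 -> g t = W -> (forall x : R, is_derive x 1 W (w x)) ->
  bounded_lipschitz M W -> bounded_lipschitz M w ->
  dx (fun s => Dleft a (g s)) t x = - (dcoef a * a * ker_diff a (-1) w x).
Proof.
move=> a01 gW dW WM wM; rewrite /dx gW.
have sg1 : `|-1 : R| <= 1 by rewrite normrN1.
have dk := is_derive_ker_diff x a01 sg1 dW WM wM.
rewrite (_ : Dleft a W = (fun x => (- (dcoef a * a)) * ker_diff a (-1) W x)); last first.
  by apply/funext => y; rewrite (Dleft_ker_diff _ a01 dW WM wM) mulrA mulNr.
by rewrite derive1E; case: (is_deriveZ (- (dcoef a * a)) dk) => _ ->; rewrite /GRing.scale/= mulNr.
Qed.

(** * Duality *)

Lemma Rintegral_support (R : realType) (h : R -> R) (D : set R) :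
  (forall x, ~ D x -> h x = 0) -> \int[mu]_x h x = \int[mu]_(x in D) h x.
Proof.
move=> h0; rewrite [RHS]Rintegral_mkcond; apply: eq_Rintegral => x _.
rewrite patchE; case: ifPn => // /negP xD.
by rewrite h0// => /mem_set.
Qed.

Lemma integrable_compact_support (R : realType) (h : R -> R) (r : R) :
  continuous h -> (forall x, r < `|x| -> h x = 0) ->
  mu.-integrable setT (EFin \o h).
Proof.
move=> ch h0; pose J : set R := `[- r, r]%classic.
have mJ : measurable J by exact: measurable_itv.
have : mu.-integrable J (EFin \o h).
  apply: continuous_compact_integrable; first exact: segment_compact.
  exact: continuous_subspaceT.
rewrite -[X in mu.-integrable X _]setTI => /integrable_restrict.
move=> /(_ mJ measurableT); apply: eq_integrable => // x _ /=.
rewrite patchE; case: ifPn => // /negP xJ; rewrite h0// ltNge.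
by apply/negP => xr; apply: xJ; rewrite inE /J/= in_itv/= -ler_norml.
Qed.

Lemma Rintegral_derive_compact_support (R : realType) (F f : R -> R) (r : R) :
  (forall x : R, is_derive x 1 F (f x)) -> continuous f ->
  (forall x, r < `|x| -> F x = 0) -> (forall x, r < `|x| -> f x = 0) ->
  \int[mu]_x f x = 0.
Proof.
(* Positive and larger than [r] whatever the sign of [r], so that [F] vanishes at both ends of
   [-b, b]. *)
move=> dF cf F0 f0; pose b := `|r| + 1.
have b0 : 0 < b by rewrite ltr_wpDl.
have rb : r < b by rewrite (le_lt_trans (ler_norm r))// ltrDl.
rewrite (@Rintegral_support _ _ `[- b, b]%classic); last first.
  move=> x xb; apply: f0; rewrite ltNge; apply/negP => xr; apply: xb => /=.
  by rewrite in_itv/= -ler_norml (le_trans xr)// ltW.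
have bb : - b < b by rewrite gtrN.
have [|x _|_ ->] := @FTC2_is_derive R F f _ _ bb.
- by move=> x _; exact: dF.
- exact: cf.
- by rewrite !F0 ?subr0// ?normrN gtr0_norm.
Qed.

(** Integrability of every section makes each inner real-valued integral equal to the extended one,
    so that the exchange passes through [fine]. *)
Lemma RFubini (R : realType) (k : R -> R -> R) :
  (mu \x mu)%E.-integrable setT (fun z : R * R => (k z.1 z.2)%:E) ->
  (forall x, mu.-integrable setT (EFin \o k x)) ->
  (forall s, mu.-integrable setT (EFin \o k ^~ s)) ->
  mu.-integrable setT (EFin \o (fun x => \int[mu]_s k x s)) /\
  \int[mu]_x \int[mu]_s k x s = \int[mu]_s \int[mu]_x k x s.
Proof.
move=> ik ikx iks.
have FE : EFin \o (fun x => \int[mu]_s k x s) =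
    fubini_F mu (fun z : R * R => (k z.1 z.2)%:E).
  apply/funext => x /=; rewrite /Rintegral fineK//.
  exact: integrable_fin_num (ikx x).
split; first by rewrite FE; exact: integrable_fubini_F.
congr fine; have := Fubini ik; rewrite /=.
have GE : EFin \o (fun s => \int[mu]_x k x s) =
    (fun s => \int[mu]_x (k x s)%:E)%E.
  apply/funext => s /=; rewrite /Rintegral fineK//.
  exact: integrable_fin_num (iks s).
move: FE => /(congr1 (fun h => \int[mu]_x h x))%E ->.
by move: GE => /(congr1 (fun h => \int[mu]_x h x))%E ->.
Qed.

(** By Tonelli, integrating first in the first variable: translation invariance removes the shift by
    c s and leaves the product of the two L1 norms. *)
Lemma integrable_shear (R : realType) (c : R) (f g : R -> R) :
  mu.-integrable setT (EFin \o f) -> mu.-integrable setT (EFin \o g) ->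
  (mu \x mu)%E.-integrable setT
    (fun z : R * R => (f (z.1 + c * z.2) * g z.2)%:E).
Proof.
move=> /[dup] fi /integrableP[mf fy] /[dup] gi /integrableP[mg gy].
have mf' : measurable_fun setT f by apply/measurable_EFinP.
have mg' : measurable_fun setT g by apply/measurable_EFinP.
have mz1 : measurable_fun setT (fun z : R * R => z.1) by exact: measurable_fst.
have mz2 : measurable_fun setT (fun z : R * R => z.2) by exact: measurable_snd.
have mz : measurable_fun setT (fun z : R * R => z.1 + c * z.2).
  apply: measurable_funD => //.
  by apply: measurable_funM => //; exact: measurable_cst.
have mk : measurable_fun setT (fun z : R * R => (f (z.1 + c * z.2) * g z.2)%:E).
  apply/measurable_EFinP; apply: measurable_funM.
    exact: (measurableT_comp mf' mz).
  exact: (measurableT_comp mg' mz2).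
have mk' : measurable_fun (setT : set (measurableTypeR R * measurableTypeR R))
  (fun z : measurableTypeR R * measurableTypeR R => (f (z.1 + c * z.2) * g z.2)%:E).
  exact: mk.
have := (@integrable21ltyP _ _ _ _ R mu mu _ mk').2; apply.
rewrite (eq_integral (fun y : measurableTypeR R =>
  (\int[mu]_x `|(f x)%:E| * `|(g y)%:E|)%E)); last first.
  move=> y _ /=; under eq_integral do rewrite normrM EFinM.
  rewrite ge0_integralZr//; last first.
    apply/measurable_EFinP; apply: measurableT_comp => //.
    apply: (measurableT_comp mf').
    by apply: measurable_funD => //; exact: measurable_cst.
  congr (_ * _)%E.
  rewrite (ge0_integral_measure_preserving (h := fun x => `|f x|)
    (measure_preserving_shift (c * y)))//.
  exact: measurableT_comp.
rewrite ge0_integralZl//; last 2 first.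
  by apply/measurable_EFinP; exact: measurableT_comp.
  exact: integral_ge0.
by rewrite lte_mul_pinfty// ?integral_ge0// ge0_fin_numE ?integral_ge0.
Qed.

(* Dominates [(dpsi (x + s) - dpsi x) * ker a s], uniformly over all [dpsi]
   bounded and Lipschitz with constant [M] and supported in [[- r, r]]. *)
Definition shear_bound (R : realType) (a M r : R) (x s : R) : R :=
  (M + M) * ((\1_(`[- r, r]%classic : set R) (x + 1 * s) * (Num.min 1 s * ker a s)) +
             (\1_(`[- r, r]%classic : set R) (x + 0 * s) * (Num.min 1 s * ker a s))).

Lemma integrable_shear_bound (R : realType) (a M r : R) : 0 < a < 1 ->
  (mu \x mu)%E.-integrable setT (fun z : R * R => (shear_bound a M r z.1 z.2)%:E).
Proof.
move=> a01.
have i1 : mu.-integrable setT (EFin \o (\1_(`[- r, r]%classic : set R) : R -> R)).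
  exact: integrable_indic_itv.
have i2 := integrable_min_ker a01.
have i3 := RintegrableD measurableT (integrable_shear 1 i1 i2) (integrable_shear 0 i1 i2).
exact: (RintegrableZl (M + M) measurableT i3).
Qed.

Lemma shear_bound_ge0 (R : realType) (a M r x s : R) : 0 <= M ->
  0 <= shear_bound a M r x s.
Proof.
move=> M0; have ms : 0 <= Num.min 1 s * ker a s.
  have [s0|s0] := leP s 0; first by rewrite ker_le0E// mulr0.
  by rewrite mulr_ge0 ?ker_ge0// le_min ler01 ltW.
by rewrite mulr_ge0 ?addr_ge0// mulr_ge0.
Qed.

Lemma integrable_shear_bound_section (R : realType) (a M r x : R) : 0 < a < 1 ->
  mu.-integrable setT (EFin \o shear_bound a M r x).
Proof.
move=> a01; have m1 c : measurable_fun setT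
    (fun s : R => \1_(`[- r, r]%classic : set R) (x + c * s) : R).
  apply: (@measurableT_comp _ _ _ _ _ _ (\1_(`[- r, r]%classic : set R) : R -> R)).
    exact: measurable_indic.
  apply: measurable_funD; first exact: measurable_cst.
  by apply: measurable_funM => //; exact: measurable_cst.
have mm : measurable_fun setT (fun s : R => Num.min 1 s * ker a s).
  apply: measurable_funM => //; apply: measurable_minr => //; exact: measurable_cst.
have i c : mu.-integrable setT (EFin \o (fun s : R =>
    \1_(`[- r, r]%classic : set R) (x + c * s) * (Num.min 1 s * ker a s))).
  apply: (@le_integrable _ _ _ mu _ _ _ (EFin \o (fun s => Num.min 1 s * ker a s))) => //.
  - by apply/measurable_EFinP; exact: (measurable_funM (m1 c) mm).
  - move=> s _ /=; rewrite lee_fin normrM ler_piMl//.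
    by rewrite indicE ger0_norm// lern1 leq_b1.
  - exact: integrable_min_ker.
apply: RintegrableZl => //; apply: RintegrableD => //; exact: i.
Qed.

(** If x and x + s both lie outside [-r, r] the increment is zero; otherwise at least one of the two
    indicators equals 1 and the bound 2 M min(1, s) is available. *)
Lemma shear_bound_dominates (R : realType) (a M r : R) (dpsi : R -> R) :
  bounded_lipschitz M dpsi -> (forall x, r < `|x| -> dpsi x = 0) ->
  forall x s, `|(dpsi (x + 1 * s) - dpsi x) * ker a s| <= shear_bound a M r x s.
Proof.
move=> dM d0 x s; have M0 := bounded_lipschitz_ge0 dM.
have [s0|s0] := leP s 0; first by rewrite ker_le0E// mulr0 normr0 shear_bound_ge0.
have ms : 0 <= Num.min 1 s by rewrite le_min ler01 ltW.
have sg1 : `|1 : R| <= 1 by rewrite normr1.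
have H := bounded_lipschitz_diff sg1 dM x s0.
rewrite normrM (ger0_norm (ker_ge0 _ _)) /shear_bound mul0r addr0.
have := ker_ge0 a s; move: (ker a s) => K K0.
rewrite -mulrDl !mulrA ler_wpM2r//.
have in1 (y : R) : r < `|y| \/ (\1_(`[- r, r]%classic : set R) y = 1 :> R).
  have [|yr] := ltP r `|y|; first by left.
  by right; rewrite indicE mem_set//= in_itv/= -ler_norml.
have i0 (y : R) : 0 <= \1_(`[- r, r]%classic : set R) y :> R by [].
have [xs|->] := in1 (x + 1 * s).
  have [xr|->] := in1 x.
    rewrite (d0 _ xs) (d0 _ xr) subr0 normr0 ?mulr_ge0 ?addr_ge0//.
  rewrite (le_trans H)// -mulrA ler_wpM2l ?addr_ge0// ler_peMl// lerDr.
  exact: i0.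
rewrite (le_trans H)// -mulrA ler_wpM2l ?addr_ge0// ler_peMl// lerDl.
exact: i0.
Qed.

(** An integrable majorant for the nonlocal term that sees the test function only through [M] and
    [r], hence the same at all times. *)
Definition ker_bound (R : realType) (a M r x : R) : R :=
  \int[mu]_s shear_bound a M r x s.

Lemma integrable_ker_bound (R : realType) (a M r : R) : 0 < a < 1 ->
  mu.-integrable setT (EFin \o ker_bound a M r).
Proof.
move=> a01; have := integrable_fubini_F (integrable_shear_bound M r a01).
apply: eq_integrable => // x _; rewrite /ker_bound /Rintegral /= fineK//.
exact: integrable_fin_num (integrable_shear_bound_section M r x a01).
Qed.

Lemma ker_diff_bound (R : realType) (a M r : R) (dpsi : R -> R) : 0 < a < 1 ->
  bounded_lipschitz M dpsi -> (forall x, r < `|x| -> dpsi x = 0) ->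
  forall x, `|ker_diff a 1 dpsi x| <= ker_bound a M r x.
Proof.
move=> a01 dM d0 x; have sg1 : `|1 : R| <= 1 by rewrite normr1.
have ik := integrable_ker_diff x a01 sg1 dM.
apply: le_trans (le_normr_Rintegral _ ik) _ => //.
apply: le_Rintegral => //.
- by have := integrable_abse ik; apply: eq_integrable.
- exact: integrable_shear_bound_section.
- by move=> s _; exact: shear_bound_dominates.
Qed.

(* Integrates the derivative of [x |-> V x * (psi (x + s) - psi x)], then shifts
   the variable. *)
Lemma shift_by_parts (R : realType) (M r s : R) (V v psi dpsi : R -> R) :
  (forall x : R, is_derive x 1 V (v x)) -> bounded_lipschitz M v ->
  (forall x : R, is_derive x 1 psi (dpsi x)) -> bounded_lipschitz M dpsi ->
  (forall x, r < `|x| -> psi x = 0) -> (forall x, r < `|x| -> dpsi x = 0) ->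
  \int[mu]_x (V x * (dpsi (x + s) - dpsi x)) =
  - \int[mu]_x ((v (x - s) - v x) * psi x).
Proof.
move=> dV vM dp dpM p0 dp0.
have cV := is_derive_continuous dV.
have cp := is_derive_continuous dp.
have cv := bounded_lipschitz_continuous vM.
have cdp := bounded_lipschitz_continuous dpM.
have sh c (h : R -> R) : continuous h -> continuous (fun x => h (x + c)).
  move=> ch x; apply: (@continuous_comp _ _ _ (fun x => x + c) h); last exact: ch.
  by apply: cvgD; [exact: cvg_id|exact: cvg_cst].
(* The radius is enlarged by |s| so that a function and its translate by [s] vanish together. *)
have far (h : R -> R) x : (forall x, r < `|x| -> h x = 0) -> r + `|s| < `|x| ->
    h x = 0 /\ h (x + s) = 0.
  move=> h0 rx; split; apply: h0; first by rewrite (le_lt_trans _ rx)// lerDl.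
  rewrite -(ltrD2r `|s|) (lt_le_trans rx)//.
  by rewrite -{1}[x](addrK s) (le_trans (ler_normB _ _)).
have dF (x : R) : is_derive x 1 (fun x => V x * (psi (x + s) - psi x))
    (V x * (dpsi (x + s) - dpsi x) + v x * (psi (x + s) - psi x)).
  have dps := @is_derive_comp_shift R psi x s _ (dp _).
  have := is_deriveM (dV x) (is_deriveB dps (dp x)).
  move/is_derive_change; apply => //.
  by congr (_ + _); exact: mulrC.
have c1 : continuous (fun x => V x * (dpsi (x + s) - dpsi x)).
  move=> x; apply: cvgM; first exact: cV.
  by apply: cvgB; [exact: sh|exact: cdp].
have c2 : continuous (fun x => v x * psi (x + s)).
  by move=> x; apply: cvgM; [exact: cv|exact: sh].
have c3 : continuous (fun x => v x * psi x).
  by move=> x; apply: cvgM; [exact: cv|exact: cp].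
have c4 : continuous (fun x => v (x - s) * psi x).
  by move=> x; apply: cvgM; [exact: sh|exact: cp].
have i1 : mu.-integrable setT (EFin \o (fun x => V x * (dpsi (x + s) - dpsi x))).
  apply: (integrable_compact_support c1 (r := r + `|s|)) => x /(far _ _ dp0)[-> ->].
  by rewrite subr0 mulr0.
have i2 : mu.-integrable setT (EFin \o (fun x => v x * psi (x + s))).
  apply: (integrable_compact_support c2 (r := r + `|s|)) => x /(far _ _ p0)[_ ->].
  by rewrite mulr0.
have i3 : mu.-integrable setT (EFin \o (fun x => v x * psi x)).
  by apply: (integrable_compact_support c3 (r := r)) => x /p0 ->; rewrite mulr0.
have i4 : mu.-integrable setT (EFin \o (fun x => v (x - s) * psi x)).
  by apply: (integrable_compact_support c4 (r := r)) => x /p0 ->; rewrite mulr0.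
have := Rintegral_derive_compact_support dF (r := r + `|s|).
have cF : continuous (fun x => V x * (dpsi (x + s) - dpsi x) + v x * (psi (x + s) - psi x)).
  move=> x; apply: cvgD; first exact: c1.
  by apply: cvgM; [exact: cv|apply: cvgB; [exact: sh|exact: cp]].
move=> /(_ cF) H.
have {H} : \int[mu]_x (V x * (dpsi (x + s) - dpsi x) + (v x * psi (x + s) - v x * psi x)) = 0.
  rewrite -[RHS]H.
  - by apply: eq_Rintegral => x _; rewrite (mulrBr (v x)).
  - by move=> x /(far _ _ p0)[-> ->]; rewrite subr0 mulr0.
  - move=> x rx; have [-> ->] := far _ _ p0 rx; have [-> ->] := far _ _ dp0 rx.
    by rewrite subr0 !mulr0 addr0.
rewrite RintegralD//; last exact: RintegrableB.
rewrite RintegralB//.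
have -> : \int[mu]_x (v x * psi (x + s)) = \int[mu]_x (v (x - s) * psi x).
  rewrite [RHS](integral_measure_preserving (measure_preserving_shift s))//.
  - by rewrite preimage_setT; apply: eq_Rintegral => x _; rewrite addrK.
  - exact: continuous_measurable_fun.
  - by rewrite preimage_setT; move: i2; apply: eq_integrable => // x _ /=; rewrite addrK.
have -> : \int[mu]_x ((v (x - s) - v x) * psi x) =
    \int[mu]_x (v (x - s) * psi x) - \int[mu]_x (v x * psi x).
  by rewrite -RintegralB//; apply: eq_Rintegral => x _; rewrite mulrBl.
by move/eqP; rewrite addr_eq0 => /eqP.
Qed.

(** Both sides are iterated integrals over (x, s) that converge absolutely: the first by
    [shear_bound], the second because [psi] is integrable. After the exchange, the inner integrals
    over x agree for each [s] by [shift_by_parts]. *)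
Lemma ker_diff_duality (R : realType) (a M r : R) (V v psi dpsi : R -> R) :
  0 < a < 1 ->
  (forall x : R, is_derive x 1 V (v x)) ->
  bounded_lipschitz M V -> bounded_lipschitz M v ->
  (forall x : R, is_derive x 1 psi (dpsi x)) ->
  bounded_lipschitz M psi -> bounded_lipschitz M dpsi ->
  (forall x, r < `|x| -> psi x = 0) -> (forall x, r < `|x| -> dpsi x = 0) ->
  [/\ mu.-integrable setT (EFin \o (fun x => V x * ker_diff a 1 dpsi x)),
      mu.-integrable setT (EFin \o (fun x => psi x * ker_diff a (-1) v x)) &
      \int[mu]_x (V x * ker_diff a 1 dpsi x) =
      - \int[mu]_x (psi x * ker_diff a (-1) v x)].
Proof.
move=> a01 dV VM vM dp pM dpM p0 dp0.
have sg1 : `|1 : R| <= 1 by rewrite normr1.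
have sgN1 : `|-1 : R| <= 1 by rewrite normrN1.
have M0 := bounded_lipschitz_ge0 VM.
have cV := bounded_lipschitz_continuous VM.
have cv := bounded_lipschitz_continuous vM.
have cp := bounded_lipschitz_continuous pM.
have cdp := bounded_lipschitz_continuous dpM.
have sh c (h : R -> R) : continuous h -> continuous (fun x => h (x + c)).
  move=> ch x; apply: (@continuous_comp _ _ _ (fun x => x + c) h); last exact: ch.
  by apply: cvgD; [exact: cvg_id|exact: cvg_cst].
have mz1 : measurable_fun setT (fun z : R * R => z.1) by exact: measurable_fst.
have mz2 : measurable_fun setT (fun z : R * R => z.2) by exact: measurable_snd.
have mfst (h : R -> R) : continuous h -> measurable_fun setT (fun z : R * R => h z.1).
  by move=> ch; exact: (measurableT_comp (continuous_measurable_fun ch) mz1).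
have msum c (h : R -> R) : continuous h ->
    measurable_fun setT (fun z : R * R => h (z.1 + c * z.2)).
  move=> ch; apply: (measurableT_comp (continuous_measurable_fun ch)).
  apply: measurable_funD => //.
  by apply: measurable_funM => //; exact: measurable_cst.
have mker : measurable_fun setT (fun z : R * R => ker a z.2).
  exact: (measurableT_comp (measurable_ker a) mz2).
pose k x s := V x * ((dpsi (x + 1 * s) - dpsi x) * ker a s).
pose m x s := - psi x * ((v (x + -1 * s) - v x) * ker a s).
have mk : measurable_fun setT (fun z : R * R => k z.1 z.2).
  apply: measurable_funM; first exact: mfst.
  by apply: measurable_funM => //; apply: measurable_funB; [exact: msum|exact: mfst].
have mm : measurable_fun setT (fun z : R * R => m z.1 z.2).
  apply: measurable_funM; first by apply: measurable_funN; exact: mfst.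
  by apply: measurable_funM => //; apply: measurable_funB; [exact: msum|exact: mfst].
have ik : (mu \x mu)%E.-integrable setT (fun z : R * R => (k z.1 z.2)%:E).
  have := RintegrableZl M measurableT (integrable_shear_bound M r a01).
  apply: le_integrable => //; first exact/measurable_EFinP.
  move=> z _ /=; rewrite lee_fin /k normrM [leRHS]normrM ler_pM//.
    by rewrite (ger0_norm M0); exact: VM.1.
  rewrite [leRHS]ger0_norm ?shear_bound_ge0//.
  exact: shear_bound_dominates.
have im : (mu \x mu)%E.-integrable setT (fun z : R * R => (m z.1 z.2)%:E).
  have ip : mu.-integrable setT (EFin \o psi).
    exact: (integrable_compact_support cp p0).
  have := RintegrableZl (M + M) measurableT
    (integrable_shear 0 ip (integrable_min_ker a01)).
  apply: le_integrable => //; first exact/measurable_EFinP.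
  move=> z _ /=; rewrite lee_fin mul0r addr0 /m.
  have [s0|s0] := leP z.2 0; first by rewrite ker_le0E// !mulr0.
  have H := bounded_lipschitz_diff sgN1 vM z.1 s0.
  have ms : 0 <= (M + M) * Num.min 1 z.2.
    by rewrite mulr_ge0 ?addr_ge0// le_min ler01 ltW.
  rewrite [leLHS]normrM normrN [in leRHS]mulrCA [leRHS]normrM ler_wpM2l//.
  move: (ker a z.2) => K.
  by rewrite mulrA normrM [leRHS]normrM ler_wpM2r// [leRHS]ger0_norm.
have ikx x : mu.-integrable setT (EFin \o k x).
  by apply: RintegrableZl => //; exact: integrable_ker_diff dpM.
have imx x : mu.-integrable setT (EFin \o m x).
  by apply: RintegrableZl => //; exact: integrable_ker_diff vM.
have kE s : k ^~ s = (fun x => ker a s * (V x * (dpsi (x + s) - dpsi x))).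
  by apply/funext => x; rewrite /k mul1r mulrA mulrC.
have mE s : m ^~ s = (fun x => - ker a s * ((v (x - s) - v x) * psi x)).
  by apply/funext => x; rewrite /m mulN1r; ring.
have iks' s : mu.-integrable setT (EFin \o (fun x => V x * (dpsi (x + s) - dpsi x))).
  apply: (@integrable_compact_support _ _ (r + `|s|)).
    move=> x; apply: cvgM; first exact: cV.
    by apply: cvgB; [exact: sh|exact: cdp].
  move=> x rx; rewrite !dp0 ?subr0 ?mulr0//.
    by rewrite (le_lt_trans _ rx)// lerDl.
  rewrite -(ltrD2r `|s|) (lt_le_trans rx)//.
  by rewrite -{1}[x](addrK s) (le_trans (ler_normB _ _)).
have ims' s : mu.-integrable setT (EFin \o (fun x => (v (x - s) - v x) * psi x)).
  apply: (@integrable_compact_support _ _ r).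
    move=> x; apply: cvgM; last exact: cp.
    by apply: cvgB; [exact: sh|exact: cv].
  by move=> x rx; rewrite p0// mulr0.
have iks s : mu.-integrable setT (EFin \o k ^~ s).
  by rewrite kE; exact: RintegrableZl.
have ims s : mu.-integrable setT (EFin \o m ^~ s).
  by rewrite mE; exact: RintegrableZl.
have kdE x : \int[mu]_s k x s = V x * ker_diff a 1 dpsi x.
  by rewrite RintegralZl//; exact: integrable_ker_diff dpM.
have mdE x : \int[mu]_s m x s = - psi x * ker_diff a (-1) v x.
  by rewrite RintegralZl//; exact: integrable_ker_diff vM.
have [i1 e1] := RFubini ik ikx iks; have [i2 e2] := RFubini im imx ims.
have kmE : \int[mu]_s \int[mu]_x k x s = \int[mu]_s \int[mu]_x m x s.
  apply: eq_Rintegral => s _.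
  transitivity (\int[mu]_x (ker a s * (V x * (dpsi (x + s) - dpsi x)))).
    by apply: eq_Rintegral => x _; have := congr1 (fun h => h x) (kE s).
  transitivity (\int[mu]_x (- ker a s * ((v (x - s) - v x) * psi x))); last first.
    by apply: eq_Rintegral => x _; have := congr1 (fun h => h x) (mE s).
  rewrite (RintegralZl _ measurableT (iks' s)) (RintegralZl _ measurableT (ims' s)).
  by rewrite (shift_by_parts s dV vM dp dpM p0 dp0) mulrN mulNr.
move: e1 e2 i1 i2; rewrite (funext kdE) (funext mdE) => e1 e2 i1 i2.
have i3 : mu.-integrable setT (EFin \o (fun x => psi x * ker_diff a (-1) v x)).
  have := RintegrableZl (-1) measurableT i2; apply: eq_integrable => [//|x _].
  by congr (_%:E); rewrite mulN1r mulNr opprK.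
split; [exact: i1|exact: i3|].
rewrite e1 kmE -e2 -[RHS]mulN1r -(RintegralZl _ measurableT i3).
by apply: eq_Rintegral => x _; rewrite mulN1r mulNr.
Qed.

(** * The convexity inequality *)

Lemma bounded_lipschitz_le (R : realType) (M N : R) (g : R -> R) :
  M <= N -> bounded_lipschitz M g -> bounded_lipschitz N g.
Proof.
move=> MN [gM gL]; split => [x|x y]; first exact: le_trans MN.
by apply: le_trans (gL x y) _; rewrite ler_wpM2r.
Qed.

Lemma bounded_lipschitz_mul (R : realType) (M N : R) (g h : R -> R) :
  bounded_lipschitz M g -> bounded_lipschitz N h ->
  bounded_lipschitz (M * N + M * N) (fun x => g x * h x).
Proof.
move=> gM hN; have M0 := bounded_lipschitz_ge0 gM.
have N0 := bounded_lipschitz_ge0 hN; case: gM hN => gM gL [hM hL].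
split=> [x|x y].
  rewrite normrM (@le_trans _ _ (M * N))//; first exact: ler_pM.
  by rewrite lerDl mulr_ge0.
have -> : g x * h x - g y * h y = g x * (h x - h y) + (g x - g y) * h y by ring.
rewrite (le_trans (ler_normD _ _))// [leRHS]mulrDl lerD// normrM.
  by rewrite -mulrA ler_pM.
by rewrite mulrAC ler_pM.
Qed.

Lemma bounded_lipschitz_comp (R : realType) (M L B : R) (de U : R -> R) :
  0 <= L -> bounded_lipschitz M U ->
  (forall v, `|v| <= M -> `|de v| <= B) ->
  (forall v v', `|v| <= M -> `|v'| <= M -> `|de v - de v'| <= L * `|v - v'|) ->
  bounded_lipschitz (Num.max B (L * M)) (fun x => de (U x)).
Proof.
move=> L0 [UM UL] deB deL; split=> [x|x y].
  by rewrite le_max deB.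
rewrite (le_trans (deL _ _ (UM x) (UM y)))//.
rewrite (@le_trans _ _ (L * (M * `|x - y|)))//; first by rewrite ler_wpM2l.
by rewrite mulrA ler_wpM2r// le_max lexx orbT.
Qed.

Lemma ker_diff_convex (R : realType) (a M L : R) (e de U w : R -> R) (x : R) :
  0 < a < 1 -> 0 <= L ->
  (forall v : R, is_derive v 1 e (de v)) -> continuous de ->
  (forall v v', `|v| <= M -> `|v'| <= M -> `|de v - de v'| <= L * `|v - v'|) ->
  (forall v v', 0 <= e v' - e v - de v * (v' - v)) ->
  (forall x : R, is_derive x 1 U (w x)) ->
  bounded_lipschitz M U -> bounded_lipschitz M w ->
  ker_diff a (-1) (fun y => de (U y) * w y) x <= de (U x) * ker_diff a (-1) w x.
Proof.
move=> a01 L0 de_e cde deL gap dU UM wM.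
have /andP[a0 a1] := a01.
have sgN1 : `|-1 : R| <= 1 by rewrite normrN1.
have M0 := bounded_lipschitz_ge0 UM.
have cU := bounded_lipschitz_continuous UM.
have cw := bounded_lipschitz_continuous wM.
(* L M s bounds the increment of e' along U, and the last factor M bounds [w]; this is the linear
   bound on the derivative of the gap [E] below. *)
pose C := L * M * M.
have C0 : 0 <= C by rewrite !mulr_ge0.
have crefl (h : R -> R) : continuous h -> continuous (fun s => h (x - s)).
  move=> ch s; apply: (@continuous_comp _ _ _ (fun s => x - s) h); last exact: ch.
  by apply: cvgB; [exact: cvg_cst|exact: cvg_id].
have drefl (h dh : R -> R) : (forall y : R, is_derive y 1 h (dh y)) ->
    forall s : R, is_derive s 1 (fun s => h (x - s)) (- dh (x - s)).
  move=> dhh s.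
  have dr : is_derive s 1 (fun y : R => x - y) (-1).
    apply: (is_derive_change (is_deriveB (is_derive_cst x s 1) (is_derive_id s 1))) => //.
    by rewrite sub0r.
  have := @is_derive1_comp R h (fun y : R => x - y) s _ _ (dhh _) dr.
  by move/is_derive_change; apply => //; rewrite mulrN1.
have cdeU : continuous (fun y => de (U y)).
  by move=> y; apply: (@continuous_comp _ _ _ U de); [exact: cU|exact: cde].
have deU (y : R) : is_derive y 1 (fun y => e (U y)) (de (U y) * w y).
  exact: (@is_derive1_comp R e U y _ _ (de_e _) (dU _)).
(* [E] is the convexity gap of [e] along [s |-> U (x - s)]: the difference of the
   two sides is the integral of [E^`() * ker a], which is nonnegative by parts
   since [E] is nonnegative and O(s ^ 2) at 0. *)
pose E s := e (U (x - s)) - e (U x) - de (U x) * (U (x - s) - U x).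
pose h s := (de (U x) - de (U (x - s))) * w (x - s).
have E_ge0 s : 0 <= E s by exact: gap.
have dE (s : R) : is_derive s 1 E (h s).
  have d1 := is_deriveB (drefl _ _ deU s) (is_derive_cst (e (U x)) s 1).
  have d2 := is_deriveB (drefl _ _ dU s) (is_derive_cst (U x) s 1).
  have := is_deriveB d1 (is_deriveZ (de (U x)) d2).
  by move/is_derive_change; apply => //; rewrite /GRing.scale/= /h; ring.
have ch : continuous h.
  move=> s; apply: cvgM; last exact: crefl.
  by apply: cvgB; [exact: cvg_cst|exact: (crefl (fun y => de (U y)))].
have cE := is_derive_continuous dE.
have hC s : `|h s| <= C * `|s|.
  rewrite normrM /C mulrAC ler_pM//; last exact: wM.1.
  apply: le_trans (deL _ _ (UM.1 _) (UM.1 _)) _.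
  rewrite -mulrA ler_wpM2l//; apply: le_trans (UM.2 _ _) _.
  by rewrite subKr.
have EC (s : R) : 0 < s -> `|E s| <= C * s * s.
  move=> s0; have [|c] := @MVT_segment R E h 0 s (ltW s0) (fun z _ => dE z).
    exact: continuous_subspaceT.
  rewrite in_itv/= => /andP[c0 cs]; rewrite {2}/E !subr0 !subrr mulr0 !subr0 => ->.
  rewrite normrM (ger0_norm (ltW s0)) ler_wpM2r ?(ltW s0)//.
  by rewrite (le_trans (hC _))// ler_wpM2l// ger0_norm.
have hmin (s : R) : 0 < s -> `|h s| <= (C + C) * Num.min 1 s.
  move=> s0; have [s1|s1] := leP s 1.
    rewrite (le_trans (hC _))// (ger0_norm (ltW s0)) ler_wpM2r ?(ltW s0)//.
    by rewrite lerDl.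
  rewrite mulr1 normrM (@le_trans _ _ (L * (M + M) * M))//; last first.
    by rewrite /C mulrDr mulrDl.
  rewrite ler_pM//; last exact: wM.1.
  rewrite (le_trans (deL _ _ (UM.1 _) (UM.1 _)))// ler_wpM2l//.
  by rewrite (le_trans (ler_normB _ _))// lerD// UM.1.
have ih : mu.-integrable setT (EFin \o (fun s => h s * ker a s)).
  apply: integrable_ker_dominated hmin => //.
  exact: continuous_measurable_fun.
have h_ge0 (S : R) : 0 < S -> 0 <= \int[mu]_(s in `]0, S]) (h s * ker a s).
  move=> S0.
  (* Multiplied by the kernel this is E(s) s^(-a-2), the term in which the kernel gets
     differentiated. The quotient is written as a power so that its measurability is immediate. *)
  pose g s := E s * s `^ (-1).
  have gE (s : R) : 0 < s -> g s = E s / s.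
    by move=> s0; rewrite /g powR_inv1// ltW.
  have gC (s : R) : 0 < s -> `|g s| <= C * s.
    move=> s0; rewrite gE// normrM normfV (ger0_norm (ltW s0)).
    by rewrite ler_pdivrMr// EC.
  have mg : measurable_fun setT g.
    by apply: measurable_funM => //; exact: continuous_measurable_fun.
  have i1 : mu.-integrable `]0, S] (EFin \o (fun s => h s * ker a s)).
    exact: integrable_subset.
  have i2 : mu.-integrable `]0, S] (EFin \o (fun s => g s * ker a s)).
    exact: (@integrable_ker_oc _ _ C).
  have i3 : mu.-integrable `]0, S] (EFin \o (fun s => (a + 1) * (g s * ker a s))).
    exact: RintegrableZl.
  pose f s := h s * ker a s - (a + 1) * (g s * ker a s).
  pose F s := E s * s `^ (- (a + 1)).
  (* The quadratic bound on [E] gives O(s^(1-a)), which vanishes at 0 because a < 1. *)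
  have F0 : F s @[s --> 0^'+] --> 0.
    apply: (@powR_cvg0_dominated _ _ C (1 - a)); first by rewrite subr_gt0.
    move=> s s0; rewrite normrM (ger0_norm (powR_ge0 _ _)).
    have -> : s `^ (1 - a) = s * (s * s `^ (- (a + 1))).
      by rewrite !mulr_powR//; congr (_ `^ _); ring.
    by rewrite !mulrA ler_wpM2r ?powR_ge0// EC.
  have dF (s : R) : 0 < s -> is_derive s 1 F (f s).
    move=> s0; have := is_deriveM (dE s) (is_derive1_powR (- (a + 1)) s0).
    move/is_derive_change; apply => //; rewrite /GRing.scale/= /f gE// ker_gt0E//.
    have -> : s `^ (- (a + 1)) = s * s `^ (- (a + 1) - 1).
      by rewrite mulr_powR//; congr (_ `^ _); ring.
    by field; rewrite gt_eqF.
  have cf (s : R) : 0 < s -> {for s, continuous f}.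
    move=> s0; have ck := @continuous_ker R a s s0.
    apply: cvgB; first by apply: cvgM => //; exact: ch.
    apply: cvgM; first exact: cvg_cst.
    apply: cvgM => //; apply: cvgM; first exact: cE.
    exact: continuous_powR_gt0.
  have fi : mu.-integrable `]0, S] (EFin \o f) by exact: RintegrableB.
  (* Hence the integral of [h] against the kernel over (0, S] is F(S) plus (a + 1) times that of
     [g], and both terms inherit the sign of the gap. *)
  have := improper_FTC2 S0 dF cf fi F0.
  rewrite (RintegralB _ i1 i3)// (RintegralZl _ _ i2)// => /eqP.
  rewrite subr_eq => /eqP ->.
  have F_ge0 : 0 <= F S by exact: mulr_ge0 (E_ge0 _) (powR_ge0 _ _).
  have g_ge0 : 0 <= \int[mu]_(s in `]0, S]) (g s * ker a s).
    apply: Rintegral_ge0 => s _.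
    exact: mulr_ge0 (mulr_ge0 (E_ge0 _) (powR_ge0 _ _)) (ker_ge0 _ _).
  apply: addr_ge0 F_ge0 _; apply: mulr_ge0 g_ge0; exact: addr_ge0 (ltW a0) ler01.
have int_h_ge0 : 0 <= \int[mu]_s (h s * ker a s).
  have cv : \int[mu]_(s in `]0, n.+1%:R]) (h s * ker a s) @[n --> \oo] -->
      \int[mu]_s (h s * ker a s).
    apply: Rintegral_cvg_exhaustion => // s.
    rewrite mulf_eq0 negb_or => /andP[_ ks]; near=> n.
    rewrite /= in_itv/=; apply/andP; split.
      by apply: contraNT ks; rewrite -leNgt => /ker_le0E ->.
    near: n; exists (Num.truncn s) => // n /= sn.
    by rewrite ltW// (lt_le_trans (truncnS_gt s))// ler_nat ltnS.
  rewrite -(cvg_lim (@Rhausdorff R) cv); apply: limr_ge; first exact: cvgP cv.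
  by near=> n; exact: h_ge0.
have iw := integrable_ker_diff x a01 sgN1 wM.
suff -> : ker_diff a (-1) (fun y => de (U y) * w y) x =
    de (U x) * ker_diff a (-1) w x - \int[mu]_s (h s * ker a s).
  by rewrite gerBl.
rewrite -(RintegralZl _ measurableT iw).
have iw' := RintegrableZl (de (U x)) measurableT iw.
rewrite -(RintegralB measurableT iw' ih); apply: eq_Rintegral => s _.
by rewrite mulN1r /h; ring.
Unshelve. all: by end_near. Qed.

(** * Convex entropies and their regularization *)

Lemma continuous_bounded_itv (R : realType) (g : R -> R) (N : R) :
  continuous g -> exists2 B : R, 0 <= B & forall x, `|x| <= N -> `|g x| <= B.
Proof.
move=> cg; have [N0|N0] := leP 0 N; last first.
  by exists 0 => // x xN; have := le_lt_trans (normr_ge0 x) (le_lt_trans xN N0); rewrite ltxx.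
have NN : - N <= N by rewrite (le_trans _ N0)// oppr_le0.
have cn : {within `[- N, N], continuous (fun x => `|g x|)}.
  apply: continuous_subspaceT => x.
  by apply: (@continuous_comp _ _ _ g Num.norm); [exact: cg|exact: norm_continuous].
have [c _ cB] := EVT_max NN cn.
exists `|g c| => // x xN; apply: cB.
by rewrite in_itv/= -ler_norml.
Qed.

Lemma derive_lipschitz_itv (R : realType) (W w : R -> R) (N B : R) :
  (forall x : R, is_derive x 1 W (w x)) ->
  (forall x, `|x| <= N -> `|w x| <= B) ->
  forall x y, `|x| <= N -> `|y| <= N -> `|W x - W y| <= B * `|x - y|.
Proof.
move=> dW wB; wlog : / forall x y, y <= x -> `|x| <= N -> `|y| <= N ->
    `|W x - W y| <= B * `|x - y|.
  apply=> x y yx xN yN.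
  have [|c cyx ->] := @MVT_segment R W w y x yx.
    by apply: continuous_subspaceT; exact: is_derive_continuous dW.
  rewrite normrM ler_wpM2r// wB// ler_norml.
  move: cyx xN yN; rewrite in_itv/= !ler_norml => /andP[yc cx] /andP[_ xN] /andP[Ny _].
  by rewrite (le_trans Ny)// (le_trans cx).
move=> H x y; have [/H//|/ltW/H {}H xN yN] := leP y x.
by rewrite distrC [`|x - y|]distrC H.
Qed.

Lemma is_derive_oriented_integral (R : realType) (g : R -> R) (v : R) :
  continuous g -> is_derive v 1 (oriented_integral g 0) (g v).
Proof.
(* A base point strictly to the left of both 0 and [v]: near [v] the oriented integral is then a
   difference of two values of one primitive, whatever the sign of [v]. *)
move=> cg; pose c := Num.min 0 v - 1.
have c0 : c < 0 by rewrite /c ltrBlDr add0r (le_lt_trans _ ltr01)// ge_min lexx.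
have cv : c < v by rewrite /c ltrBlDr (@le_lt_trans _ _ v) ?ltrDl// ge_min lexx orbT.
pose G (x : R) := \int[mu]_(t in `[c, x]) g t.
have dG (y : R) : c < y -> is_derive y 1 G (g y).
  move=> cy; have iy : mu.-integrable `[c, y + 1] (EFin \o g).
    apply: continuous_compact_integrable; first exact: segment_compact.
    exact: continuous_subspaceT.
  have yy : y < y + 1 by rewrite ltrDl.
  have [d1 d2] := continuous_FTC1_closed yy iy cy (cg y).
  by split; [exact: d1|rewrite -derive1E; exact: d2].
have FTC x y : c < x -> x < y -> \int[mu]_(t in `[x, y]) g t = G y - G x.
  move=> cx xy; have [|z _|//] := @FTC2_is_derive R G g x y xy.
    by move=> z; rewrite in_itv/= => /andP[xz _]; apply: dG; exact: lt_le_trans xz.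
  exact: cg.
have OE x : c < x -> oriented_integral g 0 x = G x - G 0.
  move=> cx; rewrite /oriented_integral; case: (ltgtP 0 x) => [x0|x0|<-].
  - exact: FTC.
  - by rewrite FTC// opprB.
  - by rewrite set_itv1 Rintegral_set1 subrr.
have dG0 : is_derive v 1 (fun x => G x - G 0) (g v).
  by apply: (is_derive_change (is_deriveB (dG v cv) (is_derive_cst (G 0) v 1))) => //; rewrite subr0.
apply: near_eq_is_derive dG0.
near=> x; rewrite OE//; near: x; exact: lt_nbhsr.
Unshelve. all: by end_near. Qed.

(** * Chord inequalities for convex functions, and Steklov means *)

Lemma convex_functionE (R : realType) (eta : R -> R) :
  @convex_function R R^o setT eta ->
  forall t x y, 0 <= t -> t <= 1 ->
    eta (t * x + (1 - t) * y) <= t * eta x + (1 - t) * eta y.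
Proof.
move=> ceta t x y t0 t1.
have := ceta (Itv01 t0 t1) x y (in_setT _) (in_setT _).
by rewrite !convRE.
Qed.

(** Both y and x + h are convex combinations of x and y + h, with the weights t = h / (y - x + h)
    and 1 - t interchanged; the two convexity inequalities add up to the claim. *)
Lemma convex_increment (R : realType) (eta : R -> R) (h : R) :
  @convex_function R R^o setT eta -> 0 < h ->
  forall x y, x <= y -> eta (x + h) - eta x <= eta (y + h) - eta y.
Proof.
move=> /convex_functionE ceta h0 x y xy.
pose d := y - x + h.
have d0 : 0 < d by rewrite ltr_wpDl// subr_ge0.
pose t := h / d.
have t0 : 0 <= t by rewrite divr_ge0 ?(ltW h0) ?(ltW d0).
have t1 : t <= 1 by rewrite ler_pdivrMr// mul1r lerDr subr_ge0.
have dn : y - x + h != 0 by rewrite gt_eqF.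
have := ceta t x (y + h) t0 t1.
have -> : t * x + (1 - t) * (y + h) = y by rewrite /t /d; field.
have := ceta t (y + h) x t0 t1.
have -> : t * (y + h) + (1 - t) * x = x + h by rewrite /t /d; field.
by lra.
Qed.

(** Monotonicity of chord slopes, cleared of denominators; (z - y) / (z - x) is the weight of x in
    y. *)
Lemma convex_slope (R : realType) (eta : R -> R) :
  @convex_function R R^o setT eta -> forall x y z, x < y -> y < z ->
  (eta y - eta x) * (z - y) <= (eta z - eta y) * (y - x).
Proof.
move=> /convex_functionE ceta x y z xy yz.
have xz : 0 < z - x by rewrite subr_gt0 (lt_trans xy).
pose t := (z - y) / (z - x).
have t0 : 0 <= t by rewrite divr_ge0 ?(ltW xz)// subr_ge0 ltW.
have t1 : t <= 1 by rewrite ler_pdivrMr// mul1r lerB// ltW.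
have := ceta t x z t0 t1.
have xzn : z - x != 0 by rewrite gt_eqF.
have -> : t * x + (1 - t) * z = y by rewrite /t; field.
rewrite -(ler_pM2r xz).
have -> : (t * eta x + (1 - t) * eta z) * (z - x) =
   (z - y) * eta x + (y - x) * eta z by rewrite /t; field.
by lra.
Qed.

(** The slope of a chord over [y, x] lies between those of the unit chords over [y - 1, y] and
    [x, x + 1], each at most 2B in absolute value when [B] bounds [eta] on [-N - 1, N + 1]. *)
Lemma convex_lipschitz_itv (R : realType) (eta : R -> R) (N : R) :
  @convex_function R R^o setT eta -> continuous eta ->
  exists2 L : R, 0 <= L & forall x y, `|x| <= N -> `|y| <= N ->
    `|eta x - eta y| <= L * `|x - y|.
Proof.
move=> ceta eta_cont.
have [B B0 etaB] := continuous_bounded_itv (N + 1) eta_cont.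
exists (B + B); first exact: addr_ge0.
have nb x d : `|x| <= N -> `|d| <= 1 -> `|eta (x + d)| <= B.
  by move=> xN d1; rewrite etaB// (le_trans (ler_normD _ _))// lerD.
have n0 x : `|x| <= N -> `|eta x| <= B.
  by move=> xN; rewrite -[x]addr0 nb// normr0.
wlog : / forall x y, y < x -> `|x| <= N -> `|y| <= N ->
    `|eta x - eta y| <= (B + B) * `|x - y|.
  apply=> x y yx xN yN.
  have x1 : x < x + 1 by rewrite ltrDl.
  have y1 : y - 1 < y by rewrite gtrBl.
  have := convex_slope ceta yx x1; have := convex_slope ceta y1 yx.
  have -> : x + 1 - x = 1 by ring.
  have -> : y - (y - 1) = 1 by ring.
  rewrite !mulr1 (gtr0_norm (_ : 0 < x - y)) ?subr_gt0// => H1 H2.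
  have xy0 : 0 <= x - y by rewrite subr_ge0 ltW.
  rewrite ler_norml; apply/andP; split.
    rewrite (le_trans _ H1)// -mulNr ler_wpM2r//.
    have /ler_normlP[] := n0 y yN; have /ler_normlP[] := nb y (-1) yN (ltac:(by rewrite normrN1)).
    by lra.
  rewrite (le_trans H2)// ler_wpM2r//.
  have /ler_normlP[] := n0 x xN; have /ler_normlP[] := nb x 1 xN (ltac:(by rewrite normr1)).
  by lra.
move=> H x y; case: (ltgtP x y) => [xy xN yN|xy|-> _ _]; last by rewrite !subrr normr0 mulr0.
  by rewrite distrC [`|x - y|]distrC H.
exact: H.
Qed.

(* A single average is smooth enough: a convex function is locally Lipschitz,
   so its Steklov mean is convex with a locally Lipschitz derivative. *)
Definition steklov (R : realType) (eta : R -> R) (h v : R) : R :=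
  h^-1 * (oriented_integral eta 0 (v + h) - oriented_integral eta 0 v).

Lemma is_derive_steklov (R : realType) (eta : R -> R) (h v : R) :
  continuous eta ->
  is_derive v 1 (steklov eta h) (h^-1 * (eta (v + h) - eta v)).
Proof.
move=> ceta.
have d1 := @is_derive_comp_shift R _ v h _ (is_derive_oriented_integral (v + h) ceta).
exact: (is_deriveZ h^-1 (is_deriveB d1 (is_derive_oriented_integral v ceta))).
Qed.

(** The derivative of the mean is a difference quotient of [eta], nondecreasing by
    [convex_increment]; the mean value theorem on either side of [v] then puts the graph above its
    tangent. *)
Lemma steklov_gap (R : realType) (eta : R -> R) (h v v' : R) :
  @convex_function R R^o setT eta -> continuous eta -> 0 < h ->
  0 <= steklov eta h v' - steklov eta h v - h^-1 * (eta (v + h) - eta v) * (v' - v).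
Proof.
move=> ceta eta_cont h0.
pose de v := h^-1 * (eta (v + h) - eta v).
have de_nd x y : x <= y -> de x <= de y.
  by move=> xy; rewrite ler_wpM2l ?invr_ge0 ?(ltW h0)// convex_increment.
have dS (x : R) : is_derive x 1 (steklov eta h) (de x) by exact: is_derive_steklov.
have cS := is_derive_continuous dS.
rewrite -/(de v); case: (ltgtP v v') => [vv|vv|<-]; last by rewrite !subrr mulr0 subrr.
- have [|c + ->] := @MVT_segment R (steklov eta h) de v v' (ltW vv).
    exact: continuous_subspaceT.
  rewrite in_itv/= => /andP[vc _]; rewrite -mulrBl mulr_ge0 ?subr_ge0 ?de_nd//.
  exact: ltW.
- have [|c + E] := @MVT_segment R (steklov eta h) de v' v (ltW vv).
    exact: continuous_subspaceT.
  rewrite in_itv/= => /andP[_ cv]; rewrite -[steklov eta h v' - _]opprB E.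
  have -> : - (de c * (v - v')) - de v * (v' - v) = (de v - de c) * (v - v') by ring.
  by rewrite mulr_ge0 ?subr_ge0 ?de_nd// ltW.
Qed.

(** By the mean value theorem the average is the value of [eta] at some point of [v, v + h]. *)
Lemma steklov_approx (R : realType) (eta : R -> R) (L N h v : R) :
  continuous eta -> 0 <= L ->
  (forall x y, `|x| <= N -> `|y| <= N -> `|eta x - eta y| <= L * `|x - y|) ->
  0 < h -> `|v| + h <= N -> `|steklov eta h v - eta v| <= L * h.
Proof.
move=> ceta L0 etaL h0 vhN; have vh : v < v + h by rewrite ltrDl.
have dO (x : R) := is_derive_oriented_integral x ceta.
have cO := is_derive_continuous dO.
have [|c + E] := @MVT_segment R (oriented_integral eta 0) eta v (v + h) (ltW vh).
  exact: continuous_subspaceT.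
rewrite in_itv/= => /andP[vc cvh].
have hn : h != 0 by rewrite gt_eqF.
have -> : steklov eta h v = eta c by rewrite /steklov E addrAC subrr add0r mulrCA mulVf// mulr1.
have cv : `|c - v| <= h by rewrite ger0_norm ?subr_ge0// lerBlDl.
rewrite (le_trans (etaL _ _ _ _))//.
- rewrite (le_trans _ vhN)// -[c](subrK v) addrC.
  by rewrite (le_trans (ler_normD _ _))// lerD2l.
- by rewrite (le_trans _ vhN)// lerDl ltW.
- by rewrite ler_wpM2l.
Qed.

(** * The entropy flux: its derivative and its dependence on the entropy *)

Lemma smooth_derive1n (R : realType) (f : R -> R) (n : nat) (v : R) :
  smooth f -> is_derive v 1 (derive1n n f) (derive1n n.+1 f v).
Proof. by move=> /(_ n v) df; split; [exact: df|rewrite derive1nS derive1E]. Qed.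

Lemma smooth_derive1n_continuous (R : realType) (f : R -> R) (n : nat) :
  smooth f -> continuous (derive1n n f).
Proof.
by move=> fs; apply: (@is_derive_continuous R _ (derive1n n.+1 f)) => v; exact: smooth_derive1n.
Qed.

(** The product rule gives f'' e + f' e', and the integral in the flux removes f'' e. The flux is
    thus a primitive of f' e' integrated by parts, a form that still makes sense for a
    nondifferentiable entropy. *)
Lemma is_derive_entropy_flux (R : realType) (f e de : R -> R) (v : R) :
  smooth f -> (forall v : R, is_derive v 1 e (de v)) ->
  is_derive v 1 (entropy_flux f e) (derive1 f v * de v).
Proof.
move=> fs dee; have ce := is_derive_continuous dee.
have cfe : continuous (fun z : R => derive1n 2 f z * e z).
  move=> z; apply: cvgM; [exact: (@smooth_derive1n_continuous R f 2 fs)|exact: ce].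
have d1 : is_derive v 1 (derive1 f) (derive1n 2 f v) := (@smooth_derive1n R f 1 v fs).
have := is_deriveB (is_deriveB (is_deriveM d1 (dee v))
  (is_derive_cst (derive1 f 0 * e 0) v 1)) (is_derive_oriented_integral v cfe).
move/is_derive_change; apply => //.
by rewrite /GRing.scale/=; ring.
Qed.

(** The flux involves the entropy but not its derivative, so a uniform error on [-M, M] carries
    over: [F1] and [F2] bound f' and f'' there, and the integral from 0 to v has length at most
    |M|. *)
Lemma entropy_flux_approx (R : realType) (f eta : R -> R) (M : R) :
  smooth f -> continuous eta ->
  exists2 C : R, 0 <= C & forall (e : R -> R) (d : R), continuous e ->
    (forall v, `|v| <= M -> `|e v - eta v| <= d) ->
    forall v, `|v| <= M ->
      `|entropy_flux f e v - entropy_flux f eta v| <= C * d.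
Proof.
move=> fs ceta.
have cf1 : continuous (derive1 f) := (@smooth_derive1n_continuous R f 1 fs).
have cf2 : continuous (derive1n 2 f) := (@smooth_derive1n_continuous R f 2 fs).
have [F1 F10 f1] := continuous_bounded_itv M cf1.
have [F2 F20 f2] := continuous_bounded_itv M cf2.
exists (F1 + F1 + F2 * `|M|); first by rewrite !addr_ge0// mulr_ge0.
move=> e d ce ed v vM.
have M0 : `|0 : R| <= M by rewrite normr0 (le_trans _ vM).
have d0 : 0 <= d by rewrite (le_trans _ (ed 0 M0)).
have cg1 : continuous (fun z : R => derive1n 2 f z * e z).
  by move=> z; apply: cvgM; [exact: cf2|exact: ce].
have cg2 : continuous (fun z : R => derive1n 2 f z * eta z).
  by move=> z; apply: cvgM; [exact: cf2|exact: ceta].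
have dO (x : R) := is_deriveB (is_derive_oriented_integral x cg1)
  (is_derive_oriented_integral x cg2).
have OB : forall x, `|x| <= M ->
    `|derive1n 2 f x * e x - derive1n 2 f x * eta x| <= F2 * d.
  by move=> x xM; rewrite -mulrBr normrM ler_pM// ?f2 ?ed.
have := derive_lipschitz_itv dO OB vM M0.
have O0 (g : R -> R) : oriented_integral g 0 0 = 0.
  by rewrite /oriented_integral lexx set_itv1 Rintegral_set1.
rewrite !fctE/= !O0 !subr0 => HO.
rewrite /entropy_flux.
set O1 := oriented_integral _ 0 v in HO *.
set O2 := oriented_integral (fun z => derive1n 2 f z * eta z) 0 v in HO *.
have -> : derive1 f v * e v - derive1 f 0 * e 0 - O1 -
    (derive1 f v * eta v - derive1 f 0 * eta 0 - O2) =
    derive1 f v * (e v - eta v) - derive1 f 0 * (e 0 - eta 0) - (O1 - O2) by ring.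
rewrite (le_trans (ler_normB _ _))// !mulrDl lerD//; last first.
  rewrite (le_trans HO)// -mulrA -mulrA ler_wpM2l// mulrC ler_wpM2r//.
  exact: le_trans vM (ler_norm M).
rewrite (le_trans (ler_normB _ _))// lerD// normrM ler_pM//; by [apply: f1|apply: ed].
Qed.

(** * The inequality at a fixed time *)

Lemma RintegrableM_bounded (R : realType) (B : R) (h g : R -> R) :
  measurable_fun setT h -> (forall x, `|h x| <= B) ->
  mu.-integrable setT (EFin \o g) ->
  mu.-integrable setT (EFin \o (fun x => h x * g x)).
Proof.
move=> mh hB ig; have B0 : 0 <= B by exact: le_trans (hB 0).
have mg : measurable_fun setT g by apply/measurable_EFinP; exact: measurable_int ig.
apply: (le_integrable _ _ _ (RintegrableZl B measurableT ig)) => //.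
  by apply/measurable_EFinP; exact: measurable_funM.
by move=> x _ /=; rewrite lee_fin !normrM ler_wpM2r// (ger0_norm B0).
Qed.

Lemma continuous_entropy_flux (R : realType) (f eta : R -> R) :
  smooth f -> continuous eta -> continuous (entropy_flux f eta).
Proof.
move=> fs ceta v.
have cf1 : continuous (derive1 f) := @smooth_derive1n_continuous R f 1 fs.
have cg : continuous (fun z : R => derive1n 2 f z * eta z).
  by move=> z; apply: cvgM; [exact: (@smooth_derive1n_continuous R f 2 fs)|exact: ceta].
apply: cvgB; last exact: (is_derive_continuous (fun x => is_derive_oriented_integral x cg)).
apply: cvgB; last exact: cvg_cst.
by apply: cvgM; [exact: cf1|exact: ceta].
Qed.

(** The first conclusion of the duality, taken with the constant 1 for [V] and 0 for [v]. *)
Lemma integrable_ker_diff_test (R : realType) (a M r : R) (psi dpsi : R -> R) :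
  0 < a < 1 -> (forall x : R, is_derive x 1 psi (dpsi x)) ->
  bounded_lipschitz M psi -> bounded_lipschitz M dpsi ->
  (forall x, r < `|x| -> psi x = 0) -> (forall x, r < `|x| -> dpsi x = 0) ->
  mu.-integrable setT (EFin \o ker_diff a 1 dpsi).
Proof.
move=> a01 dp pM dpM p0 dp0; pose N := Num.max 1 M.
have N0 : 0 <= N by rewrite le_max ler01.
have cN c : `|c| <= N -> bounded_lipschitz N (cst c : R -> R).
  by move=> cN; split => // x y; rewrite subrr normr0 mulr_ge0.
have MN : M <= N by rewrite le_max lexx orbT.
have d1 (x : R) : is_derive x 1 (cst 1 : R -> R) ((cst 0 : R -> R) x).
  exact: is_derive_cst.
have B1 : bounded_lipschitz N (cst 1 : R -> R) by apply: cN; rewrite normr1 le_max lexx.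
have B0 : bounded_lipschitz N (cst 0 : R -> R) by apply: cN; rewrite normr0.
have [] := ker_diff_duality a01 d1 B1 B0 dp
  (bounded_lipschitz_le MN pM) (bounded_lipschitz_le MN dpM) p0 dp0.
by move=> + _ _; apply: eq_integrable => // x _ /=; rewrite mul1r.
Qed.

(** The integrand of the entropy inequality at a frozen time, the derivative of [Dright] being
    replaced by its kernel form; [k] stands for eps times [dcoef a * a]. *)
Definition entropy_integrand (R : realType) (k a : R) (f eta U psi_t dpsi : R -> R)
    (x : R) : R :=
  eta (U x) * psi_t x + entropy_flux f eta (U x) * dpsi x +
  k * (eta (U x) * ker_diff a 1 dpsi x).

Lemma integrable_entropy_integrand (R : realType) (k a M r : R)
    (f eta U psi_t psi dpsi : R -> R) :
  0 < a < 1 -> smooth f -> continuous eta -> bounded_lipschitz M U ->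
  continuous psi_t -> (forall x, r < `|x| -> psi_t x = 0) ->
  (forall x : R, is_derive x 1 psi (dpsi x)) ->
  bounded_lipschitz M psi -> bounded_lipschitz M dpsi ->
  (forall x, r < `|x| -> psi x = 0) -> (forall x, r < `|x| -> dpsi x = 0) ->
  mu.-integrable setT (EFin \o entropy_integrand k a f eta U psi_t dpsi).
Proof.
move=> a01 fs ceta UM cpt pt0 dp pM dpM p0 dp0.
have cU := bounded_lipschitz_continuous UM.
have cetaU : continuous (fun x => eta (U x)).
  by move=> x; apply: (@continuous_comp _ _ _ U eta); [exact: cU|exact: ceta].
have [B _ etaB] := continuous_bounded_itv M ceta.
apply: RintegrableD => //; first apply: RintegrableD => //.
- apply: (@integrable_compact_support _ _ r) => [x|x /pt0 ->]; last by rewrite mulr0.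
  by apply: cvgM; [exact: cetaU|exact: cpt].
- apply: (@integrable_compact_support _ _ r) => [x|x /dp0 ->]; last by rewrite mulr0.
  apply: cvgM; last exact: (bounded_lipschitz_continuous dpM).
  apply: (@continuous_comp _ _ _ U (entropy_flux f eta)); first exact: cU.
  exact: continuous_entropy_flux.
- apply: RintegrableZl => //; apply: (@RintegrableM_bounded _ B).
  + exact: continuous_measurable_fun.
  + by move=> x; apply: etaB; exact: UM.1.
  + exact: (integrable_ker_diff_test a01 dp pM dpM p0 dp0).
Qed.

(** The constant is chosen before the approximating entropy and the time slices, so the error is
    uniform in time and linear in [d]. It is the integral of a majorant built from the indicator of
    [-r, r] for the two local terms and [ker_bound] for the nonlocal one. *)
Lemma entropy_integrand_approx (R : realType) (k a M r : R) (f eta : R -> R) :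
  0 < a < 1 -> 0 <= k -> 0 <= M -> smooth f -> continuous eta ->
  exists C : R, forall (e U psi_t psi dpsi : R -> R) (d : R), 0 <= d ->
    continuous e -> (forall v, `|v| <= M -> `|e v - eta v| <= d) ->
    bounded_lipschitz M U ->
    continuous psi_t -> (forall x, r < `|x| -> psi_t x = 0) ->
    (forall x, `|psi_t x| <= M) ->
    (forall x : R, is_derive x 1 psi (dpsi x)) ->
    bounded_lipschitz M psi -> bounded_lipschitz M dpsi ->
    (forall x, r < `|x| -> psi x = 0) -> (forall x, r < `|x| -> dpsi x = 0) ->
    \int[mu]_x entropy_integrand k a f e U psi_t dpsi x - d * C <=
    \int[mu]_x entropy_integrand k a f eta U psi_t dpsi x.
Proof.
move=> a01 k0 M0 fs ceta.
have [Cq Cq0 qC] := entropy_flux_approx M fs ceta.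
pose B (x : R) := (M + Cq * M) * \1_(`[- r, r]%classic : set R) x + k * ker_bound a M r x.
have iB : mu.-integrable setT (EFin \o B).
  apply: RintegrableD => //; apply: RintegrableZl => //.
    exact: integrable_indic_itv.
  exact: integrable_ker_bound.
exists (\int[mu]_x B x) => e U psi_t psi dpsi d d0 ce ed UM cpt pt0 ptM dp pM dpM p0 dp0.
have ie := integrable_entropy_integrand k a01 fs ce UM cpt pt0 dp pM dpM p0 dp0.
have ieta := integrable_entropy_integrand k a01 fs ceta UM cpt pt0 dp pM dpM p0 dp0.
have idB := RintegrableZl d measurableT iB.
rewrite -(RintegralZl _ measurableT iB) -(RintegralB measurableT ie idB).
apply: le_Rintegral => //; first exact: RintegrableB.
move=> x _; rewrite lerBlDr -lerBlDl.
have -> : entropy_integrand k a f e U psi_t dpsi x -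
    entropy_integrand k a f eta U psi_t dpsi x =
    (e (U x) - eta (U x)) * psi_t x +
    (entropy_flux f e (U x) - entropy_flux f eta (U x)) * dpsi x +
    k * ((e (U x) - eta (U x)) * ker_diff a 1 dpsi x).
  by rewrite /entropy_integrand; ring.
have edU := ed _ (UM.1 x).
have -> : d * B x = d * (M * \1_(`[- r, r]%classic : set R) x) +
    Cq * d * (M * \1_(`[- r, r]%classic : set R) x) + k * (d * ker_bound a M r x).
  by rewrite /B; ring.
have supp (h : R -> R) : (forall x, r < `|x| -> h x = 0) -> (forall x, `|h x| <= M) ->
    `|h x| <= M * \1_(`[- r, r]%classic : set R) x.
  move=> h0 hM; have [/h0 ->|xr] := ltP r `|x|; first by rewrite normr0 mulr_ge0.
  by rewrite indicE mem_set ?mulr1//= in_itv/= -ler_norml.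
apply: (le_trans (ler_norm _)); apply: (le_trans (ler_normD _ _)).
apply: lerD; first apply: (le_trans (ler_normD _ _)); first apply: lerD.
- by rewrite normrM ler_pM//; exact: supp.
- by rewrite normrM ler_pM//; [apply: qC => //; exact: UM.1|apply: supp => //; exact: dpM.1].
- rewrite normrM (ger0_norm k0) ler_wpM2l// normrM ler_pM//.
  exact: ker_diff_bound.
Qed.

(** The flux term is integrated by parts and the nonlocal term dualized, so that every term carries
    [psi]. The equation multiplied by e'(U) psi then reduces the claim to the pointwise inequality
    [ker_diff_convex], multiplied by k psi >= 0. The left integrand is the time derivative of e(u)
    phi when [ut] and [psi_t] are the time derivatives. *)
Lemma smooth_entropy_inequality (R : realType) (k a M L r : R)
    (f e de U w ut psi_t psi dpsi : R -> R) :
  0 < a < 1 -> 0 <= k -> smooth f -> 0 <= L ->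
  (forall v : R, is_derive v 1 e (de v)) -> continuous de ->
  (forall v v', `|v| <= M -> `|v'| <= M -> `|de v - de v'| <= L * `|v - v'|) ->
  (forall v v', 0 <= e v' - e v - de v * (v' - v)) ->
  (forall x : R, is_derive x 1 U (w x)) ->
  bounded_lipschitz M U -> bounded_lipschitz M w -> continuous ut ->
  (forall x, ut x + derive1 f (U x) * w x = - (k * ker_diff a (-1) w x)) ->
  continuous psi_t -> (forall x, r < `|x| -> psi_t x = 0) ->
  (forall x : R, is_derive x 1 psi (dpsi x)) ->
  bounded_lipschitz M psi -> bounded_lipschitz M dpsi ->
  (forall x, r < `|x| -> psi x = 0) -> (forall x, r < `|x| -> dpsi x = 0) ->
  (forall x, 0 <= psi x) ->
  \int[mu]_x (e (U x) * psi_t x + de (U x) * ut x * psi x) <=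
  \int[mu]_x entropy_integrand k a f e U psi_t dpsi x.
Proof.
move=> a01 k0 fs L0 dee cde deL gap dU UM wM cut pde cpt pt0 dp pM dpM p0 dp0 psi0.
have M0 := bounded_lipschitz_ge0 UM.
have ce := is_derive_continuous dee.
have cU := bounded_lipschitz_continuous UM.
have cw := bounded_lipschitz_continuous wM.
have cp := bounded_lipschitz_continuous pM.
have cdp := bounded_lipschitz_continuous dpM.
have compU (h : R -> R) : continuous h -> continuous (fun x => h (U x)).
  by move=> ch x; apply: (@continuous_comp _ _ _ U h); [exact: cU|exact: ch].
have cf1 : continuous (derive1 f) := @smooth_derive1n_continuous R f 1 fs.
have ceU := compU _ ce; have cdeU := compU _ cde; have cfU := compU _ cf1.
have cq : continuous (entropy_flux f e) by exact: continuous_entropy_flux.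
have cqU := compU _ cq.
have [B1 B10 eB] := continuous_bounded_itv M ce.
have [B2 B20 deB] := continuous_bounded_itv M cde.
have eV : bounded_lipschitz (Num.max B1 (B2 * M)) (fun x => e (U x)).
  apply: bounded_lipschitz_comp => //; exact: derive_lipschitz_itv dee deB.
have dedeU : bounded_lipschitz (Num.max B2 (L * M)) (fun x => de (U x)).
  exact: bounded_lipschitz_comp.
have dev := bounded_lipschitz_mul dedeU wM.
set N1 := Num.max B1 (B2 * M) in eV.
set N2 := Num.max B2 (L * M) * M + Num.max B2 (L * M) * M in dev.
pose N := Num.max N1 (Num.max N2 M).
have NN1 : N1 <= N by rewrite /N le_max lexx.
have NN2 : N2 <= N by rewrite /N !le_max lexx !orbT.
have NM : M <= N by rewrite /N !le_max lexx !orbT.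
have dV (x : R) : is_derive x 1 (fun x => e (U x)) (de (U x) * w x).
  exact: (@is_derive1_comp R e U x _ _ (dee _) (dU _)).
have [i1 i2 dual] := ker_diff_duality a01 dV (bounded_lipschitz_le NN1 eV)
  (bounded_lipschitz_le NN2 dev) dp (bounded_lipschitz_le NM pM)
  (bounded_lipschitz_le NM dpM) p0 dp0.
have icompact (h g : R -> R) : continuous h -> continuous g ->
    (forall x, r < `|x| -> g x = 0) ->
    mu.-integrable setT (EFin \o (fun x => h x * g x)).
  move=> ch cg g0; apply: (@integrable_compact_support _ _ r).
    by move=> x; apply: cvgM; [exact: ch|exact: cg].
  by move=> x /g0 ->; rewrite mulr0.
have cfdw : continuous (fun x => derive1 f (U x) * de (U x) * w x).
  by move=> x; apply: cvgM; [apply: cvgM; [exact: cfU|exact: cdeU]|exact: cw].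
have cdut : continuous (fun x => de (U x) * ut x).
  by move=> x; apply: cvgM; [exact: cdeU|exact: cut].
have j1 := icompact _ _ ceU cpt pt0.
have j2 := icompact _ _ cqU cdp dp0.
have j3 := icompact _ _ cfdw cp p0.
have j4 := icompact _ _ cdut cp p0.
have qE : \int[mu]_x (entropy_flux f e (U x) * dpsi x) =
    - \int[mu]_x (derive1 f (U x) * de (U x) * w x * psi x).
  have dF (x : R) : is_derive x 1 (fun x => entropy_flux f e (U x) * psi x)
      (entropy_flux f e (U x) * dpsi x + derive1 f (U x) * de (U x) * w x * psi x).
    have dq := @is_derive1_comp R (entropy_flux f e) U x _ _
      (is_derive_entropy_flux (U x) fs dee) (dU x).
    have := is_deriveM dq (dp x).
    by move/is_derive_change; apply => //; congr (_ + _); exact: mulrC.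
  have := Rintegral_derive_compact_support dF (r := r).
  rewrite (RintegralD measurableT j2 j3) => /(_ _ _ _)/eqP.
  rewrite addr_eq0 => H; apply/eqP/H.
  - move=> x; apply: cvgD; apply: cvgM; [exact: cqU|exact: cdp|exact: cfdw|exact: cp].
  - by move=> x /p0 ->; rewrite mulr0.
  - by move=> x rx; rewrite p0// dp0// !mulr0 addr0.
have j5 := RintegrableZl k measurableT i1.
have j6 := RintegrableZl (- k) measurableT i2.
rewrite (RintegralD measurableT j1 j4) (RintegralD measurableT _ j5); last exact: RintegrableD.
rewrite (RintegralD measurableT j1 j2) -addrA lerD2l qE.
rewrite (RintegralZl k measurableT i1) dual mulrN -mulNr.
rewrite -(RintegralZl (- k) measurableT i2) addrC lerBrDr.
rewrite -(RintegralD measurableT j4 j3).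
apply: le_Rintegral => //; first exact: RintegrableD.
move=> x _.
have := ker_diff_convex x a01 L0 dee cde deL gap dU UM wM.
move=> /(ler_wpM2l (mulr_ge0 k0 (psi0 x))) H.
have -> : de (U x) * ut x * psi x + derive1 f (U x) * de (U x) * w x * psi x =
    de (U x) * (ut x + derive1 f (U x) * w x) * psi x by ring.
rewrite pde -subr_ge0.
rewrite -subr_ge0 in H; apply: le_trans H _; rewrite le_eqVlt; apply/orP; left.
by apply/eqP; ring.
Qed.

(** * Integration in time *)

(** The integral of a nonnegative function is the supremum over the simple functions below it, and a
    larger function has more of them; measurability is not involved. *)
Lemma ge0_le_integral_nonmeasurable (R : realType) (D : set R) (f1 f2 : R -> \bar R) :
  (forall x, D x -> 0 <= f1 x)%E -> (forall x, D x -> f1 x <= f2 x)%E ->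
  (\int[mu]_(x in D) f1 x <= \int[mu]_(x in D) f2 x)%E.
Proof.
move=> f10 f12; rewrite !ge0_integralE//; last first.
  by move=> x Dx; exact: le_trans (f10 x Dx) (f12 x Dx).
apply: le_ereal_sup => _ [h hf <-]; exists h => // x.
apply: le_trans (hf x) _; rewrite !patchE; case: ifPn => // /set_mem.
exact: f12.
Qed.

(* The second disjunct is the junk value [fine +oo = 0] of the real-valued
   integral of an [F] whose positive part is not integrable. *)
Lemma le_Rintegral_or_eq0 (R : realType) (D : set R) (G F : R -> R) :
  measurable D -> mu.-integrable D (EFin \o G) ->
  (forall t, D t -> G t <= F t) ->
  \int[mu]_(t in D) G t <= \int[mu]_(t in D) F t \/ \int[mu]_(t in D) F t = 0.
Proof.
move=> mD iG GF.
have Ip : (\int[mu]_(x in D) ((EFin \o G)^\+ x) <= \int[mu]_(x in D) ((EFin \o F)^\+ x))%E.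
  apply: ge0_le_integral_nonmeasurable => x Dx //.
  by rewrite !funeposE/= ge_max le_max lee_fin GF//= le_max lexx orbT.
(* The negative part of [F] therefore always has a finite integral, and only the positive part can
   diverge. *)
have In : (\int[mu]_(x in D) ((EFin \o F)^\- x) <= \int[mu]_(x in D) ((EFin \o G)^\- x))%E.
  apply: ge0_le_integral_nonmeasurable => x Dx //.
  by rewrite !funenegE/= ge_max !le_max lee_fin lerN2 GF//= lexx orbT.
have Gn : (\int[mu]_(x in D) ((EFin \o G)^\- x) < +oo)%E.
  by apply: integrable_lty => //; exact: integrable_funeneg.
have Gfin : (\int[mu]_(x in D) (EFin \o G) x)%E \is a fin_num.
  by apply: integrable_fin_num.
have Fn0 : (0 <= \int[mu]_(x in D) ((EFin \o F)^\- x))%E by exact: integral_ge0.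
have Fnfin : (\int[mu]_(x in D) ((EFin \o F)^\- x))%E \is a fin_num.
  by rewrite ge0_fin_numE// (le_lt_trans In).
have [Fp|] := boolP ((\int[mu]_(x in D) ((EFin \o F)^\+ x))%E \is a fin_num); last first.
  rewrite ge0_fin_numE ?integral_ge0// -leNgt leye_eq => /eqP FpE; right.
  rewrite /Rintegral integralE [X in (X - _)%E]FpE.
  by move: Fnfin; case: (\int[mu]_(x in D) _)%E.
left; apply: fine_le => //.
  by rewrite integralE fin_numB; apply/andP; split; [exact: Fp|exact: Fnfin].
by rewrite integralE [leRHS]integralE; apply: leeB; [exact: Ip|exact: In].
Qed.

(** * Regularity and compact support on the half-plane *)

Lemma Ck_continuous (R : realType) (k : nat) (g : R -> R -> R) (t x : R) :
  Ck k halfplane g -> 0 < t ->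
  {for (t, x), continuous (fun q : R * R => g q.1 q.2)}.
Proof. by case: k => [|k] [cg _] t0; exact: (cg (t, x) t0). Qed.

Lemma Ck_continuous_x (R : realType) (k : nat) (g : R -> R -> R) (t : R) :
  Ck k halfplane g -> 0 < t -> continuous (g t).
Proof.
move=> cg t0 x; have := @Ck_continuous R k g t x cg t0.
have cp : (t, y) @[y --> x] --> (t, x) by exact: (cvg_pair (cvg_cst t) cvg_id).
by move=> /(cvg_comp _ _ cp).
Qed.

Lemma Ck_continuous_t (R : realType) (k : nat) (g : R -> R -> R) (t x : R) :
  Ck k halfplane g -> 0 < t -> {for t, continuous (g ^~ x)}.
Proof.
move=> cg t0; have := @Ck_continuous R k g t x cg t0.
have cp : (s, x) @[s --> t] --> (t, x) by exact: (cvg_pair cvg_id (cvg_cst x)).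
by move=> /(cvg_comp _ _ cp).
Qed.

Lemma Ck_is_derive_x (R : realType) (k : nat) (g : R -> R -> R) (t x : R) :
  Ck k.+1 halfplane g -> 0 < t -> is_derive x 1 (g t) (dx g t x).
Proof.
move=> [_ [dg _ _]] t0; have [_ d] := dg (t, x) t0.
by split; [exact: d|rewrite /dx derive1E].
Qed.

Lemma Ck_is_derive_t (R : realType) (k : nat) (g : R -> R -> R) (t x : R) :
  Ck k.+1 halfplane g -> 0 < t -> is_derive t 1 (g ^~ x) (dt g t x).
Proof.
move=> [_ [dg _ _]] t0; have [d _] := dg (t, x) t0.
by split; [exact: d|rewrite /dt derive1E].
Qed.

Lemma Ck_dx (R : realType) (k : nat) (Omega : set (R * R)) (g : R -> R -> R) :
  Ck k.+1 Omega g -> Ck k Omega (dx g).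
Proof. by case=> _ []. Qed.

Lemma Ck_dt (R : realType) (k : nat) (Omega : set (R * R)) (g : R -> R -> R) :
  Ck k.+1 Omega g -> Ck k Omega (dt g).
Proof. by case=> _ []. Qed.

(** Off a closed set the function vanishes on a whole neighbourhood, hence so does its partial
    derivative; keeping the same [K] allows iteration to second derivatives. *)
Lemma dx_support (R : realType) (K : set (R * R)) (g : R -> R -> R) :
  closed K -> (forall p, ~ K p -> g p.1 p.2 = 0) ->
  forall p, ~ K p -> dx g p.1 p.2 = 0.
Proof.
move=> cK g0 [t x] Kp; rewrite /dx derive1E -(derive_cst (0 : R) x 1).
apply: near_eq_derive.
have : \forall q \near (t, x), ~ K q.
  by apply: open_nbhs_nbhs; split => //; exact: closed_openC.
have cp : (t, y) @[y --> x] --> (t, x) by exact: (cvg_pair (cvg_cst t) cvg_id).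
by move=> /cp H; near=> y; apply: (g0 (t, y)); near: y.
Unshelve. all: by end_near. Qed.

Lemma dt_support (R : realType) (K : set (R * R)) (g : R -> R -> R) :
  closed K -> (forall p, ~ K p -> g p.1 p.2 = 0) ->
  forall p, ~ K p -> dt g p.1 p.2 = 0.
Proof.
move=> cK g0 [t x] Kp; rewrite /dt derive1E -(derive_cst (0 : R) t 1).
apply: near_eq_derive.
have : \forall q \near (t, x), ~ K q.
  by apply: open_nbhs_nbhs; split => //; exact: closed_openC.
have cp : (s, x) @[s --> t] --> (t, x) by exact: (cvg_pair cvg_id (cvg_cst x)).
by move=> /cp H; near=> s; apply: (g0 (s, x)); near: s.
Unshelve. all: by end_near. Qed.

Lemma compact_continuous_bound (R : realType) (K : set (R * R)) (h : R * R -> R) :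
  compact K -> (forall p, K p -> {for p, continuous h}) ->
  exists B, forall p, K p -> h p <= B.
Proof.
move=> cK ch; have [->|/set0P K0] := eqVneq K set0; first by exists 0.
have [|c _ cB] := @compact_EVT_max _ R h K K0 cK.
  by apply: continuous_in_subspaceT => q /set_mem; exact: ch.
by exists (h c) => q Kq; apply: cB; rewrite inE.
Qed.

Lemma compact_support_bounded (R : realType) (K : set (R * R)) (g : R -> R -> R) :
  compact K -> (forall p, K p -> {for p, continuous (fun q : R * R => g q.1 q.2)}) ->
  (forall p, ~ K p -> g p.1 p.2 = 0) ->
  exists B, forall t x, `|g t x| <= B.
Proof.
move=> cK cg g0.
have cn p : K p -> {for p, continuous (fun q : R * R => `|g q.1 q.2|)}.
  move=> /cg cgp; apply: (@continuous_comp _ _ _ (fun q : R * R => g q.1 q.2) Num.norm).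
    exact: cgp.
  exact: norm_continuous.
have [B KB] := compact_continuous_bound cK cn.
exists (Num.max 0 B) => t x; rewrite le_max.
have [/KB ->|/g0 ->] := pselect (K (t, x)); first by rewrite orbT.
by rewrite normr0 lexx.
Qed.

(** The positive lower bound in time comes from an upper bound of the continuous function 1/t on
    [K]. The maxima with 1 keep [tau] and [T] positive, even for empty [K]. *)
Lemma halfplane_compact_box (R : realType) (K : set (R * R)) :
  compact K -> K `<=` halfplane ->
  exists tau T r : R, [/\ 0 < tau, 0 < T &
    forall p, K p -> [/\ tau <= p.1, p.1 <= T & `|p.2| <= r]].
Proof.
move=> cK Khalf.
have c1 p : K p -> {for p, continuous (fun q : R * R => q.1)}.
  by move=> _; exact: cvg_fst.
have c2 p : K p -> {for p, continuous (fun q : R * R => `|q.2|)}.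
  move=> _; apply: (@continuous_comp _ _ _ (fun q : R * R => q.2) Num.norm).
    exact: cvg_snd.
  exact: norm_continuous.
have c3 p : K p -> {for p, continuous (fun q : R * R => q.1^-1)}.
  by move=> /Khalf p0; apply: cvgV; [rewrite gt_eqF|exact: cvg_fst].
have [T HT] := compact_continuous_bound cK c1.
have [r Hr] := compact_continuous_bound cK c2.
have [s Hs] := compact_continuous_bound cK c3.
exists (Num.max 1 s)^-1, (Num.max 1 T), r; split.
- by rewrite invr_gt0 lt_max ltr01.
- by rewrite lt_max ltr01.
- move=> p Kp; have p0 := Khalf _ Kp; split; last exact: Hr.
    rewrite invf_ple ?posrE ?lt_max ?ltr01//.
    by rewrite le_max Hs ?orbT.
  by rewrite le_max HT ?orbT.
Qed.

(** Differentiation under the integral sign, with a multiple of the indicator of [-r, r] as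
    majorant, makes the space integral of [gt] a continuous time derivative; the fundamental theorem
    leaves two boundary values, both zero. *)
Lemma integral_time_derivative (R : realType) (g gt : R -> R -> R) (B r t1 t2 : R) :
  (forall t x : R, 0 < t -> is_derive t 1 (g ^~ x) (gt t x)) ->
  (forall t : R, 0 < t -> continuous (g t)) ->
  (forall t : R, 0 < t -> continuous (gt t)) ->
  (forall t x : R, 0 < t -> {for t, continuous (gt ^~ x)}) ->
  (forall t x : R, 0 < t -> `|gt t x| <= B) ->
  (forall t x : R, 0 < t -> r < `|x| -> g t x = 0) ->
  (forall t x : R, 0 < t -> r < `|x| -> gt t x = 0) ->
  0 < t1 -> t1 < t2 -> (forall x, g t1 x = 0) -> (forall x, g t2 x = 0) ->
  mu.-integrable `[t1, t2] (EFin \o (fun t => \int[mu]_x gt t x)) /\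
  \int[mu]_(t in `[t1, t2]) \int[mu]_x gt t x = 0.
Proof.
move=> dg cg cgt cgtt gtB g0 gt0 t10 t12 gt1 gt2.
pose G (x : R) := `|B| * \1_(`[- r, r]%classic : set R) x.
have iG : mu.-integrable setT (EFin \o G).
  by apply: RintegrableZl => //; exact: integrable_indic_itv.
have G_ge0 x : 0 <= G x by rewrite mulr_ge0.
have gtG (t x : R) : 0 < t -> `|gt t x| <= G x.
  move=> t0; have [rx|xr] := ltP r `|x|; first by rewrite gt0// normr0.
  rewrite /G indicE mem_set ?mulr1; last by rewrite /= in_itv/= -ler_norml.
  by rewrite (le_trans (gtB _ _ t0))// ler_norm.
(* The hypotheses concern positive times only, and this neighbourhood of [t] stays among them. *)
have itv_gt0 (t s : R) : 0 < t -> `]t / 2, t + 1[%classic s -> 0 < s.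
  move=> t0; rewrite /= in_itv/= => /andP[+ _]; apply: lt_trans.
  by rewrite divr_gt0.
have itv_in (t : R) : 0 < t -> `]t / 2, t + 1[%classic t.
  by move=> t0; rewrite /= in_itv/= ltrDl ltr01 andbT ltr_pdivrMr// ltr_pMr// ltr1n.
have ig (t : R) : 0 < t -> mu.-integrable setT (EFin \o g t).
  by move=> t0; apply: (integrable_compact_support (cg t t0) (r := r)) => x; exact: g0.
have igt (t : R) : 0 < t -> mu.-integrable setT (EFin \o gt t).
  by move=> t0; apply: (integrable_compact_support (cgt t t0) (r := r)) => x; exact: gt0.
have p1E (t x : R) : 0 < t -> partial1of2 g t x = gt t x.
  by move=> t0; rewrite partial1of2E; case: (dg t x t0).
pose A t := \int[mu]_x g t x.
have dA (t : R) : 0 < t -> is_derive t 1 A (\int[mu]_x gt t x).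
  move=> t0.
  have h1 s : `]t / 2, t + 1[%classic s -> mu.-integrable setT (EFin \o g s).
    by move=> /itv_gt0 s0; apply: ig; exact: s0.
  have h2 (s x : R) : `]t / 2, t + 1[%classic s -> setT x -> derivable (g ^~ x) s 1.
    by move=> /itv_gt0 s0 _; case: (dg s x (s0 t0)).
  have h3 (s x : R) : `]t / 2, t + 1[%classic s -> setT x -> `|partial1of2 g s x| <= G x.
    by move=> /itv_gt0 s0 _; rewrite p1E ?s0// gtG ?s0.
  have d1 := @derivable_under_integral R _ _ mu g setT measurableT t _ _ (itv_in t t0) h1 h2 G G_ge0 iG h3.
  have d2 := @differentiation_under_integral R _ _ mu g setT measurableT t _ _ (itv_in t t0) h1 h2 G G_ge0 iG h3.
  split; first exact: d1.
  by rewrite -derive1E [LHS]d2; apply: eq_Rintegral => x _; exact: p1E.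
have cA (t : R) : 0 < t -> {for t, continuous (fun t => \int[mu]_x gt t x)}.
  move=> t0.
  have h1 s : `]t / 2, t + 1[%classic s -> mu.-integrable setT (EFin \o gt s).
    by move=> /itv_gt0 s0; apply: igt; exact: s0.
  have h2 : {ae mu, forall x : R, setT x -> {in (`]t / 2, t + 1[%classic : set R), continuous (gt ^~ x)}}.
    by apply: aeW => x _ s /set_mem /itv_gt0 s0; apply: cgtt; exact: s0.
  have h3 s : `]t / 2, t + 1[%classic s -> {ae mu, forall x : R, setT x -> `|gt s x| <= G x}.
    by move=> /itv_gt0 s0; apply: aeW => x _; apply: gtG; exact: s0.
  have := @continuity_under_integral R _ _ mu gt setT measurableT _ _ h1 h2 G iG h3 t.
  by apply; apply/mem_set; exact: itv_in.
have pos t : t \in `[t1, t2] -> 0 < t.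
  by rewrite in_itv/= => /andP[+ _]; exact: lt_le_trans.
have [|t /pos|i ->] := @FTC2_is_derive R A (fun t => \int[mu]_x gt t x) t1 t2 t12.
- by move=> t /pos; exact: dA.
- exact: cA.
- split; first exact: i.
  rewrite /A; under eq_Rintegral do rewrite gt2.
  rewrite -[RHS](subrr (\int[mu]_(x in (setT : set R)) 0)); congr (_ - _).
  by apply: eq_Rintegral => x _; rewrite gt1.
Qed.

Lemma ge0_of_linear_bound (R : realType) (I K : R) :
  (forall h, 0 < h -> h <= 1 -> - (h * K) <= I) -> 0 <= I.
Proof.
move=> H; rewrite leNgt; apply/negP => I0.
pose K' := `|K| + 1; have K0 : 0 < K' by rewrite ltr_wpDl.
(* With this choice h K' is at most -I/2, while the hypothesis would force it to be at least -I. *)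
pose h := Num.min 1 (- I / (K' + K')).
have KK : 0 < K' + K' by rewrite addr_gt0.
have h0 : 0 < h by rewrite lt_min ltr01 divr_gt0 ?oppr_gt0.
have h1 : h <= 1 by rewrite ge_min lexx.
have hI : h * (K' + K') <= - I by rewrite -ler_pdivlMr// ge_min lexx orbT.
have hK : h * K <= h * K'.
  by rewrite ler_wpM2l ?(ltW h0)// (le_trans (ler_norm K))// lerDl.
have hK0 : 0 < h * K' by rewrite mulr_gt0.
by have := H h h0 h1; lra.
Qed.

Lemma dcoef_ge0 (R : realType) (a : R) : 0 <= dcoef a.
Proof.
rewrite invr_ge0; apply: Rintegral_ge0 => s _.
by rewrite mulr_ge0 ?powR_ge0 ?expR_ge0.
Qed.

Lemma Rintegral_eq0 (R : realType) (h : R -> R) :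
  (forall x, h x = 0) -> \int[mu]_x h x = 0.
Proof.
by move=> h0; under eq_Rintegral do rewrite h0; rewrite Rintegral_cst// mul0r.
Qed.

Lemma ker_diff0 (R : realType) (a sg : R) (g : R -> R) (x : R) :
  (forall x, g x = 0) -> ker_diff a sg g x = 0.
Proof. by move=> g0; apply: Rintegral_eq0 => s; rewrite !g0 subrr mul0r. Qed.

Theorem theorem3p1 (R : realType) (alpha : R) (f : R -> R)
    (alpha01 : 0 < alpha < 1) (f_smooth : smooth f)
    (eps : R) (eps_gt0 : 0 < eps)
    (eta : R -> R) (eta_cont : continuous eta)
    (eta_convex : @convex_function R R^o setT eta)
    (u0 : R -> R) (u : R -> R -> R) (u_C2b : Ckb 2 halfplane u)
    (u_sol : cauchy_solution alpha eps f u0 u)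
    (phi : R -> R -> R) (phi_test : Ccinfty halfplane phi)
    (phi_ge0 : forall t x, 0 <= phi t x) :
  0 <= \int[lebesgue_measure]_(t in `]0%R, +oo[) (\int[lebesgue_measure]_x
         (eta (u t x) * dt phi t x
          + entropy_flux f eta (u t x) * dx phi t x
          + eps * (eta (u t x) * dx (fun s => Dright alpha (phi s)) t x))).
Proof.
have [phi_smooth] := phi_test; set K := closure _ => cptK Khalf.
have clK : closed K by exact: closed_closure.
have phi0 p : ~ K p -> phi p.1 p.2 = 0.
  by apply: contra_notP => /eqP p0; exact: subset_closure.
have C2phi := phi_smooth 2%N.
have C1dx := Ck_dx C2phi; have C1dt := Ck_dt C2phi; have C0dxx := Ck_dx C1dx.
have dx0 := dx_support clK phi0; have dt0 := dt_support clK phi0.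
have dxx0 := dx_support clK dx0.
have bnd k (g : R -> R -> R) : Ck k halfplane g -> (forall p, ~ K p -> g p.1 p.2 = 0) ->
    exists B, forall t x, `|g t x| <= B.
  move=> Cg g0; apply: (compact_support_bounded cptK) g0 => -[t x] Kp.
  exact: Ck_continuous Cg (Khalf _ Kp).
have [P0 phiB] := bnd _ _ C2phi phi0.
have [P1 dtB] := bnd _ _ C1dt dt0.
have [P2 dxB] := bnd _ _ C1dx dx0.
have [P3 dxxB] := bnd _ _ C0dxx dxx0.
(* Bounds on u, u_t, u_x and u_xx; the last one makes u_x Lipschitz in x, as the nonlocal operator
   requires. *)
have [C2u [[U0 uB] [[[U1 utB] _] [[U2 uxB] [_ [[U3 uxxB] _]]]]]] := u_C2b.
pose M := Num.max P0 (Num.max P1 (Num.max P2 (Num.max P3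
  (Num.max U0 (Num.max U1 (Num.max U2 U3)))))).
have MP0 : P0 <= M by rewrite !le_max lexx ?orbT.
have MP1 : P1 <= M by rewrite !le_max lexx ?orbT.
have MP2 : P2 <= M by rewrite !le_max lexx ?orbT.
have MP3 : P3 <= M by rewrite !le_max lexx ?orbT.
have MU0 : U0 <= M by rewrite !le_max lexx ?orbT.
have MU1 : U1 <= M by rewrite !le_max lexx ?orbT.
have MU2 : U2 <= M by rewrite !le_max lexx ?orbT.
have MU3 : U3 <= M by rewrite !le_max lexx ?orbT.
have M0 : 0 <= M by rewrite (le_trans _ MP0)// (le_trans _ (phiB 0 0)).
have C1ux := Ck_dx C2u; have C1ut := Ck_dt C2u.
have [tau [T [r [tau0 T0 box]]]] := halfplane_compact_box cptK Khalf.
have off_x (t x : R) : r < `|x| -> ~ K (t, x).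
  by move=> rx /box[_ _]; rewrite leNgt rx.
have off_t (t x : R) : t < tau \/ T < t -> ~ K (t, x).
  by move=> tT /box[/= t1 t2 _]; case: tT; rewrite ltNge ?t1 ?t2.
have dphi (t x : R) (t0 : 0 < t) := Ck_is_derive_x x C2phi t0.
have ddphi (t x : R) (t0 : 0 < t) := Ck_is_derive_x x C1dx t0.
have du (t x : R) (t0 : 0 < t) := Ck_is_derive_x x C2u t0.
have ddu (t x : R) (t0 : 0 < t) := Ck_is_derive_x x C1ux t0.
have phiM (t : R) : 0 < t -> bounded_lipschitz M (phi t).
  move=> t0; exact: (@derive_bounded_lipschitz R M (phi t) (dx phi t) (fun x => dphi t x t0)
    (fun x => le_trans (phiB t x) MP0) (fun x => le_trans (dxB t x) MP2)).
have dphiM (t : R) : 0 < t -> bounded_lipschitz M (dx phi t).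
  move=> t0; exact: (@derive_bounded_lipschitz R M (dx phi t) (dx (dx phi) t) (fun x => ddphi t x t0)
    (fun x => le_trans (dxB t x) MP2) (fun x => le_trans (dxxB t x) MP3)).
have uM (t : R) : 0 < t -> bounded_lipschitz M (u t).
  move=> t0; exact: (@derive_bounded_lipschitz R M (u t) (dx u t) (fun x => du t x t0)
    (fun x => le_trans (uB (t, x) t0) MU0) (fun x => le_trans (uxB (t, x) t0) MU2)).
have uxM (t : R) : 0 < t -> bounded_lipschitz M (dx u t).
  move=> t0; exact: (@derive_bounded_lipschitz R M (dx u t) (dx (dx u) t) (fun x => ddu t x t0)
    (fun x => le_trans (uxB (t, x) t0) MU2) (fun x => le_trans (uxxB (t, x) t0) MU3)).
pose k := eps * (dcoef alpha * alpha).
have k0 : 0 <= k.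
  have /andP[a0 _] := alpha01.
  by rewrite mulr_ge0 ?(ltW eps_gt0)// mulr_ge0 ?dcoef_ge0// ltW.
have pde (t x : R) : 0 < t ->
    dt u t x + derive1 f (u t x) * dx u t x = - (k * ker_diff alpha (-1) (dx u t) x).
  move=> t0; have := u_sol.1 t x t0.
  rewrite (@dx_Dleft R alpha M u t x (u t) (dx u t) alpha01 erefl
    (fun y => du t y t0) (uM t t0) (uxM t t0)).
  have df : is_derive (u t x) 1 f (derive1 f (u t x)) := @smooth_derive1n R f 0 _ f_smooth.
  have -> : dx (fun s y => f (u s y)) t x = derive1 f (u t x) * dx u t x.
    by rewrite {1}/dx derive1E; case: (@is_derive1_comp R f (u t) x _ _ df (du t x t0)).
  by move=> ->; rewrite mulrN mulrA.
pose F t := \int[mu]_x entropy_integrand k alpha f eta (u t) (dt phi t) (dx phi t) x.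
rewrite [leRHS](_ : _ = \int[mu]_(t in `]0, +oo[) F t); last first.
  apply: eq_Rintegral => t /set_mem/=; rewrite in_itv/= andbT => t0.
  apply: eq_Rintegral => x _.
  rewrite (@dx_Dright R alpha M phi t x (phi t) (dx phi t) alpha01 erefl
    (fun y => dphi t y t0) (phiM t t0) (dphiM t t0)).
  by rewrite /entropy_integrand /k; ring.
(* The radius is M + 1 because a Steklov mean of width at most 1 samples [eta] up to distance 1 from
   the range of [u]. *)
have [Lam Lam0 etaL] := convex_lipschitz_itv (M + 1) eta_convex eta_cont.
have [C approx] := entropy_integrand_approx r alpha01 k0 M0 f_smooth eta_cont.
(* Times before and after the support of [phi]; adding [tau] gives t1 < t2 without comparing [tau]
   with [T]. *)
pose t1 := tau / 2; pose t2 := T + tau + 1.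
have t10 : 0 < t1 by rewrite divr_gt0.
have t1tau : t1 < tau by rewrite ltr_pdivrMr// ltr_pMr// ltr1n.
have Tt2 : T < t2 by rewrite /t2 -addrA ltrDl addr_gt0.
have t12 : t1 < t2 by rewrite (lt_trans t1tau)// /t2 addrAC ltrDr addr_gt0.
pose D : set R := `]0, +oo[%classic.
pose J : set R := `[t1, t2]%classic.
have mD : measurable D by exact: measurable_itv.
have mJ : measurable J by exact: measurable_itv.
have JD : J `<=` D.
  move=> t; rewrite /J /D /= !in_itv/= andbT => /andP[+ _].
  exact: lt_le_trans.
(* This settles the degenerate alternative of [le_Rintegral_or_eq0], which is excluded from here
   on. *)
have [/eqP->//|I0] := boolP (\int[mu]_(t in `]0, +oo[) F t == 0).
(* The Steklov error [Lam * h] is multiplied by [C] at each time and by the length of the time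
   interval. *)
apply: (@ge0_of_linear_bound _ _ (Lam * C * (t2 - t1))) => h h0 h1.
pose e := steklov eta h; pose de v := h^-1 * (eta (v + h) - eta v).
have dee (v : R) : is_derive v 1 e (de v) by exact: is_derive_steklov.
have ce := is_derive_continuous dee.
have cde : continuous de.
  move=> v; apply: cvgM; first exact: cvg_cst.
  apply: cvgB; last exact: eta_cont.
  apply: (@continuous_comp _ _ _ (fun v => v + h) eta); last exact: eta_cont.
  by apply: cvgD; [exact: cvg_id|exact: cvg_cst].
have hi0 : 0 <= h^-1 by rewrite invr_ge0 ltW.
have vh v : `|v| <= M -> `|v + h| <= M + 1.
  by move=> vM; rewrite (le_trans (ler_normD _ _))// lerD// ger0_norm// ltW.
have v1 v : `|v| <= M -> `|v| <= M + 1 by move=> /le_trans; apply; rewrite lerDl.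
(* The factor 1/h is harmless, since this constant does not appear in the conclusion of
   [smooth_entropy_inequality]. *)
have deL v v' : `|v| <= M -> `|v'| <= M ->
    `|de v - de v'| <= h^-1 * (Lam + Lam) * `|v - v'|.
  move=> vM v'M; rewrite -mulrBr normrM (ger0_norm hi0) -mulrA ler_wpM2l//.
  have -> : eta (v + h) - eta v - (eta (v' + h) - eta v') =
    (eta (v + h) - eta (v' + h)) - (eta v - eta v') by ring.
  rewrite (le_trans (ler_normB _ _))// mulrDl lerD//; last by rewrite etaL ?v1.
  rewrite (le_trans (etaL _ _ (vh _ vM) (vh _ v'M)))// ler_wpM2l//.
  by rewrite opprD addrACA subrr addr0.
have gap v v' : 0 <= e v' - e v - de v * (v' - v) by exact: steklov_gap.
have ee v : `|v| <= M -> `|e v - eta v| <= Lam * h.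
  move=> vM; apply: (steklov_approx eta_cont Lam0 etaL) => //.
  by rewrite lerD.
have L0 : 0 <= h^-1 * (Lam + Lam) by rewrite mulr_ge0// addr_ge0.
have [B1 B10 eB] := continuous_bounded_itv M ce.
have [B2 B20 deB] := continuous_bounded_itv M cde.
pose g t x := e (u t x) * phi t x.
pose gt t x := e (u t x) * dt phi t x + de (u t x) * dt u t x * phi t x.
have compx (q : R -> R) (t : R) : continuous q -> 0 < t -> continuous (fun x => q (u t x)).
  move=> cq t0 x; apply: (@continuous_comp _ _ _ (u t) q); last exact: cq.
  exact: (Ck_continuous_x C2u t0).
have compt (q : R -> R) (t x : R) : continuous q -> 0 < t ->
    {for t, continuous (fun t => q (u t x))}.
  move=> cq t0; have cu := @Ck_continuous_t R _ _ t x C2u t0.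
  exact: (@continuous_comp _ _ _ (u ^~ x) q t cu (cq _)).
have [igt0 igtE] : mu.-integrable `[t1, t2] (EFin \o (fun t => \int[mu]_x gt t x)) /\
    \int[mu]_(t in `[t1, t2]) \int[mu]_x gt t x = 0.
  apply: (@integral_time_derivative _ g gt (B1 * M + B2 * M * M) r) => //.
  - move=> t x t0.
    have d1 := @is_derive1_comp R e (u ^~ x) t _ _ (dee _) (Ck_is_derive_t x C2u t0).
    have := is_deriveM d1 (Ck_is_derive_t x C2phi t0).
    move/is_derive_change; apply => //; congr (_ + _); exact: mulrC.
  - move=> t t0 x; apply: cvgM; first exact: compx.
    exact: (Ck_continuous_x C2phi t0).
  - move=> t t0 x; apply: cvgD; apply: cvgM.
    + exact: compx.
    + exact: (Ck_continuous_x C1dt t0).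
    + by apply: cvgM; [exact: compx|exact: (Ck_continuous_x C1ut t0)].
    + exact: (Ck_continuous_x C2phi t0).
  - move=> t x t0; apply: cvgD; apply: cvgM.
    + exact: compt.
    + exact: (@Ck_continuous_t R _ _ t x C1dt t0).
    + by apply: cvgM; [exact: compt|exact: (@Ck_continuous_t R _ _ t x C1ut t0)].
    + exact: (@Ck_continuous_t R _ _ t x C2phi t0).
  - move=> t x t0; have uxtM := (uM t t0).1 x.
    rewrite (le_trans (ler_normD _ _))// lerD//.
      by rewrite normrM ler_pM ?eB// (le_trans (dtB _ _)).
    rewrite normrM ler_pM// ?(le_trans (phiB _ _))//.
    by rewrite normrM ler_pM ?deB// (le_trans (utB (t, x) t0)).
  - by move=> t x _ rx; rewrite /g (phi0 (t, x)) ?mulr0//; exact: off_x.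
  - move=> t x _ rx; rewrite /gt (phi0 (t, x)) ?(dt0 (t, x)) ?mulr0 ?addr0//; exact: off_x.
  - by move=> x; rewrite /g (phi0 (t1, x)) ?mulr0//; apply: off_t; left.
  - by move=> x; rewrite /g (phi0 (t2, x)) ?mulr0//; apply: off_t; right.
have gtF (t : R) : 0 < t -> \int[mu]_x gt t x - Lam * h * C <= F t.
  move=> t0; have ctphi := Ck_continuous_x C1dt t0.
  have tphi0 x : r < `|x| -> dt phi t x = 0 by move=> rx; apply: (dt0 (t, x)); exact: off_x.
  have xphi0 x : r < `|x| -> dx phi t x = 0 by move=> rx; apply: (dx0 (t, x)); exact: off_x.
  have phi0' x : r < `|x| -> phi t x = 0 by move=> rx; apply: (phi0 (t, x)); exact: off_x.
  apply: le_trans (approx e (u t) (dt phi t) (phi t) (dx phi t) (Lam * h) _ ce ee (uM t t0)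
    ctphi tphi0 (fun x => le_trans (dtB t x) MP1) (fun x => dphi t x t0) (phiM t t0) (dphiM t t0)
    phi0' xphi0); last by rewrite mulr_ge0// ltW.
  rewrite lerD2r.
  exact: (smooth_entropy_inequality alpha01 k0 f_smooth L0 dee cde deL gap
    (fun x => du t x t0) (uM t t0) (uxM t t0) (Ck_continuous_x C1ut t0)
    (fun x => pde t x t0) ctphi tphi0 (fun x => dphi t x t0) (phiM t t0) (dphiM t t0)
    phi0' xphi0 (phi_ge0 t)).
(* A nonzero constant error is not integrable over the half-line, so the minorant is cut off to
   [t1, t2]; outside, [F] vanishes together with the whole slice of [phi]. *)
pose c := Lam * h * C.
pose G t := (\int[mu]_x gt t x - c) * \1_J t.
have icst : mu.-integrable J (EFin \o cst c).
  by apply: continuous_compact_integrable; [exact: segment_compact|exact: cst_continuous].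
have iG0 : mu.-integrable J (EFin \o (fun t => \int[mu]_x gt t x - c)).
  exact: RintegrableB.
have iG : mu.-integrable D (EFin \o G).
  apply: integrable_subset => //.
  move: iG0; rewrite -[X in mu.-integrable X _]setTI => /integrable_restrict.
  move=> /(_ mJ measurableT); apply: eq_integrable => // t _ /=.
  by rewrite patchE /G indicE; case: ifPn => _; rewrite ?mulr1 ?mulr0.
have GF t : D t -> G t <= F t.
  rewrite /D/= in_itv/= andbT => t0; rewrite /G indicE.
  have [_|/negP tJ] := boolP (t \in J); first by rewrite mulr1; exact: gtF.
  rewrite mulr0; have off x : ~ K (t, x).
    apply: off_t; apply/orP; rewrite -[_ || _]negbK negb_or -!leNgt; apply/negP => /andP[t3 t4].
    apply: tJ; rewrite inE /J/= in_itv/= (le_trans (ltW t1tau))//.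
    by rewrite (le_trans t4)// ltW.
  rewrite /F Rintegral_eq0// => x.
  rewrite /entropy_integrand (dt0 (t, x))// (dx0 (t, x))// ker_diff0 ?mulr0 ?addr0//.
  by move=> y; exact: (dx0 (t, y)).
have [|/eqP] := le_Rintegral_or_eq0 mD iG GF; last by rewrite (negPf I0).
apply: le_trans.
have -> : \int[mu]_(t in D) G t = \int[mu]_(t in J) (\int[mu]_x gt t x - c).
  rewrite -[in RHS](setIidr JD) Rintegral_mkcondr; apply: eq_Rintegral => t _.
  by rewrite patchE /G indicE; case: ifPn => _; rewrite ?mulr1 ?mulr0.
rewrite RintegralB// [X in _ <= X - _]igtE sub0r Rintegral_cst// lerN2.
rewrite [X in fine X](_ : _ = (t2 - t1)%:E)/=.
  by rewrite /c le_eqVlt; apply/orP; left; apply/eqP; ring.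
by rewrite /J lebesgue_measure_itv/= lte_fin t12 -EFinD.
Qed.
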